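(* Let $T>0$ and let $\Phi=(\Phi_t)$ be a process with $\Phi\in\mathscr{L}_0\cup\mathscr{L}_2\cup\mathscr{L}_2^{loc}$. Let $K\ge 1$ be a fixed natural number. For each partition $\triangle_n:\ 0=t_0<t_1<\cdots<t_n=T$ with $n>K$, let $J=\{0,1,\dots,n-1\}$ and let $J_K=\{i_1,\dots,i_K\}\subset J$ be any subset with exactly $K$ elements. Then $$\mathop{\mathrm{l.i.m.}}_{\|\triangle_n\|\to 0}\ \sum_{j\in J\setminus J_K}\Phi_{t_j}\,(B_{t_{j+1}}-B_{t_j})=\int_0^T\Phi_t\,dB_t .$$
   Context: $(\Omega,\mathcal F,(\mathcal F_t),P)$ is a probability space with a complete right-continuous filtration generated by a one-dimensional standard Brownian motion $B=(B_t)$, each $\mathcal F_t$ containing all $P$-null sets. $\mathrm{l.i.m.}$ denotes limit in mean square, i.e. in $L^2(\Omega,P)$. For a partition $\triangle_n:0=t_0<\cdots<t_n=T$, $\|\triangle_n\|=\max_{0\le i\le n-1}(t_{i+1}-t_i)$. $\Phi_t$ denotes the value of the process at time $t$ (also written $\Phi(B_t,t)$). Classes of integrands: - $\mathscr{L}_0$: processes of the form $\Phi_t(\omega)=f_0(\omega)I_{\{0\}}(t)+\sum_{k=0}^\infty f_k(\omega)I_{(s_k,s_{k+1}]}(t)$ with $0=s_0<s_1<\cdots\uparrow\infty$, $f_k$ being $\mathcal F_{s_k}$-measurable, and the $f_k$ uniformly bounded. - $\mathscr{L}_2$: measurable $(\mathcal F_t)$-adapted processes with $\mathbb E\int_0^T|\Phi_t|^2dt<\infty$.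 - $\mathscr{L}_2^{loc}$: measurable $(\mathcal F_t)$-adapted processes with $\int_0^T|\Phi_t|^2dt<\infty$. The Itô stochastic integral of a non-anticipating (adapted) process is $\int_0^T\Phi_t\,dB_t=\mathop{\mathrm{l.i.m.}}_{\|\triangle_n\|\to0}\sum_{i=0}^{n-1}\Phi_{t_i}(B_{t_{i+1}}-B_{t_i})$.
   Formalization: For Φ outside L_0, the mean-square limit defining the integral of Φ dB is assumed to exist; without this the integral is undefined, e.g. for the deterministic indicator of the rationals, which lies in L_2. *)

(* Defs.v *)
From HB Require Import structures.
From mathcomp Require Import all_boot all_order all_algebra.
From mathcomp Require Import all_classical all_reals all_analysis.

Set Implicit Arguments.
Unset Strict Implicit.
Unset Printing Implicit Defensive.

Import Order.TTheory GRing.Theory Num.Theory.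
Import numFieldNormedType.Exports.

Local Open Scope classical_set_scope.
Local Open Scope ring_scope.

(* Processes are maps R -> Omega -> R; only the times t >= 0 matter. *)

Section brownian.
Context {d : measure_display} {Omega : measurableType d} {R : realType}.
Variable P : probability Omega R.

(* Each [A i] may be taken to be [setT], so the product rule for the whole
   family contains the product rules for its subfamilies. *)
Definition independent_rvs (n : nat) (X : 'I_n -> Omega -> R) : Prop :=
  forall A : 'I_n -> set R, (forall i, measurable (A i)) ->
    P (\bigcap_(i in setT) (X i @^-1` A i)) =
    (\prod_(i < n) P (X i @^-1` A i))%E.

Record brownian_motion (B : R -> Omega -> R) : Prop := BrownianMotion {
  bm_measurable : forall t : R, 0 <= t -> measurable_fun setT (B t);
  bm_start : {ae P, forall w, B 0 w = 0};
  bm_increments_independent : forall (n : nat) (t : nat -> R),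
    0 <= t 0%N -> nondecreasing_seq t ->
    independent_rvs (fun i : 'I_n => B (t i.+1) \- B (t i));
  (* the second parameter of [normal_prob] is the standard deviation *)
  bm_increments_normal : forall s t : R, 0 <= s -> s < t ->
    forall A : set R, measurable A ->
      P ((B t \- B s) @^-1` A) = normal_prob 0 (Num.sqrt (t - s)) A;
  bm_continuous :
    {ae P, forall w, {within `[0, +oo[, continuous (fun t => B t w)}} }.

Definition null_sets : set_system Omega :=
  [set N | measurable N /\ P N = 0%E].

Definition past_events (B : R -> Omega -> R) (t : R) : set_system Omega :=
  [set A | exists u, [/\ 0 <= u, u <= t &
    exists2 Y : set R, measurable Y & A = B u @^-1` Y]].

(* The usual augmentation of the filtration generated by [B]: the least
   right-continuous one containing it and all the null sets. *)
Definition brownian_filtration (B : R -> Omega -> R) (t : R)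
    : set_system Omega :=
  \bigcap_(s in [set s | t < s]) <<s past_events B s `|` null_sets >>.

End brownian.

Section integrands.
Context {d : measure_display} {Omega : measurableType d} {R : realType}.
Variable P : probability Omega R.
Variable F : R -> set_system Omega.

Definition measurable_wrt (G : set_system Omega) (X : Omega -> R) : Prop :=
  forall Y : set R, measurable Y -> G (X @^-1` Y).

Definition adapted (Phi : R -> Omega -> R) : Prop :=
  forall t : R, 0 <= t -> measurable_wrt (F t) (Phi t).

Definition measurable_process (Phi : R -> Omega -> R) : Prop :=
  measurable_fun ((`[0, +oo[ : set R) `*` [set: Omega])
    (fun p : R * Omega => Phi p.1 p.2).

Definition class_L0 (Phi : R -> Omega -> R) : Prop :=
  exists (s : nat -> R) (f : nat -> Omega -> R),
    [/\ s 0%N = 0, increasing_seq s, s k @[k --> \oo] --> +oo,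
        (forall k, measurable_wrt (F (s k)) (f k)) /\
        (exists M : R, forall k w, `|f k w| <= M) &
        forall (t : R) w, 0 <= t ->
          Phi t w = f 0%N w * \1_[set 0] t +
            limn (series (fun k => f k w * \1_(`]s k, s k.+1]) t))].

Definition class_L2 (T : R) (Phi : R -> Omega -> R) : Prop :=
  [/\ measurable_process Phi, adapted Phi &
    (\int[P]_w \int[lebesgue_measure]_(t in `[0%R, T])
      (`|Phi t w| ^+ 2)%:E < +oo)%E].

Definition class_L2_loc (T : R) (Phi : R -> Omega -> R) : Prop :=
  [/\ measurable_process Phi, adapted Phi &
    {ae P, forall w, (\int[lebesgue_measure]_(t in `[0%R, T])
      (`|Phi t w| ^+ 2)%:E < +oo)%E}].

End integrands.

Section stochastic_sums.
Context {R : realType}.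

(* A partition 0 = t_0 < t_1 < ... < t_n = T is encoded by the sequence
   s = [:: t_1; ...; t_n] such that [itv_partition 0 T s]; n = size s. *)
Definition node (s : seq R) (i : nat) : R := nth 0 (0 :: s) i.

Definition mesh (s : seq R) : R :=
  \big[Num.max/0]_(i < size s) (node s i.+1 - node s i).

Definition mesh_to0 (T : R) : set_system (seq R) :=
  filter_from [set e : R | 0 < e]
    (fun e => [set s | itv_partition 0 T s /\ mesh s < e]).

#[global] Instance mesh_to0_filter (T : R) : Filter (mesh_to0 T).
Proof.
apply: filter_from_filter; first by exists 1 => /=.
move=> e1 e2 /= e1_gt0 e2_gt0; exists (Num.min e1 e2) => /=.
  by rewrite lt_min e1_gt0.
by move=> s [sP]; rewrite lt_min => /andP[s1 s2].
Qed.

Context {d : measure_display} {Omega : measurableType d}.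
Variable P : probability Omega R.

Definition limit_in_mean_square (T : R) (S : seq R -> Omega -> R)
    (X : Omega -> R) : Prop :=
  X \in Lfun P 2%:E /\
  ('E_P[fun w => ((S s w - X w) ^+ 2)%R] @[s --> mesh_to0 T] --> 0)%E.

Definition stochastic_sum (B Phi : R -> Omega -> R) (s : seq R)
    (J : {set 'I_(size s)}) (w : Omega) : R :=
  \sum_(j in J) Phi (node s j) w * (B (node s j.+1) w - B (node s j) w).

Definition is_ito_integral (B : R -> Omega -> R) (T : R)
    (Phi : R -> Omega -> R) (X : Omega -> R) : Prop :=
  limit_in_mean_square T (fun s => stochastic_sum B Phi [set: 'I_(size s)]) X.

Definition ito_integrable (B : R -> Omega -> R) (T : R)
    (Phi : R -> Omega -> R) : Prop :=
  exists X, is_ito_integral B T Phi X.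

(* A representative of the almost sure equivalence class of the limit; the
   junk value 0 when the limit does not exist. *)
Definition ito_integral (B : R -> Omega -> R) (T : R)
    (Phi : R -> Omega -> R) : Omega -> R :=
  xget (cst 0) [set X | is_ito_integral B T Phi X].

End stochastic_sums.

(* Main.v *)
(** A partition may be modified by inserting the endpoints of one of the small
    intervals [a, b] of another partition into it, or only [b]; the two Riemann
    sums then differ by (Phi_a - Phi_p)(B_b - B_a), where p is a fixed node.
    Both sums are close to the integral, so by the Ito isometry the omitted term
    Phi_a (B_b - B_a) is small in mean square as soon as the increment is,
    uniformly in the interval; hence K of them vanish in the limit. The isometry
    is used with values in [0, +oo], so it also provides the finiteness of the
    second moments of Phi, which is not assumed for locally square integrable
    integrands. It rests on the independence of B_v - B_t from F_t, where the
    right limit in the definition of F_t is reached through B_v - B_r, r > t.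
    For an integrand of class L0 the sums telescope around each jump and converge
    to the obvious elementary integral. *)

Require Import Defs.
From HB Require Import structures.
From mathcomp Require Import all_boot all_order all_algebra.
From mathcomp Require Import all_classical all_reals all_analysis.
From mathcomp Require Import measurable_realfun ring lra.

Set Implicit Arguments.
Unset Strict Implicit.
Unset Printing Implicit Defensive.
Set SsrOldRewriteGoalsOrder.

Import Order.TTheory GRing.Theory Num.Theory.
Import numFieldNormedType.Exports HBNNSimple.

Local Open Scope classical_set_scope.
Local Open Scope ring_scope.

(** * Gaussian moments *)

Section density.
Context d (T : measurableType d) (R : realType).

(** By monotone convergence both sides are limits of integrals of simple functions increasing to
    [f]; on each level set the equality is the hypothesis on [nu]. *)
Lemma ge0_integral_density (nu mu : {measure set T -> \bar R}) (p : T -> R)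
    (f : T -> \bar R) :
    measurable_fun [set: T] p -> (forall x, 0 <= p x) ->
    (forall A, measurable A -> nu A = \int[mu]_(x in A) (p x)%:E)%E ->
    measurable_fun [set: T] f -> (forall x, 0 <= f x)%E ->
  (\int[nu]_x f x = \int[mu]_x (f x * (p x)%:E))%E.
Proof.
move=> mp0 p0 nuE mf f0; pose f_ := nnsfun_approx measurableT mf.
have mp : measurable_fun [set: T] (EFin \o p).
  exact/measurable_EFinP.
have cf x : (f_ n x)%:E @[n --> \oo] --> f x.
  exact: cvg_nnsfun_approx.
transitivity (limn (fun n => \int[nu]_x (f_ n x)%:E)%E).
  rewrite -monotone_convergence//.
  - by apply: eq_integral => x _; apply/esym/cvg_lim => //; exact: cf.
  - by move=> n; exact/measurable_EFinP.
  - by move=> n x _; rewrite lee_fin.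
  - by move=> x _ a b ab; rewrite lee_fin; exact/lefP/nd_nnsfun_approx.
transitivity
    (limn (fun n => \int[mu]_x ((f_ n x)%:E * (p x)%:E))%E).
  congr (limn _); apply/funext => n.
  rewrite integralT_nnsfun sintegralE.
  transitivity (\int[mu]_x (\sum_(r \in range (f_ n))
      ((r * \1_(f_ n @^-1` [set r]) x)%:E * (p x)%:E)))%E; last first.
    apply: eq_integral => x _; rewrite [in RHS]fimfunE -fsumEFin//.
    by rewrite ge0_mule_fsuml// => r; exact: nnfun_muleindic_ge0.
  rewrite ge0_integral_fsum//; last 2 first.
  + move=> r; apply: emeasurable_funM => //.
    exact/measurable_EFinP/measurable_funM.
  + move=> r x _; apply: mule_ge0; last by rewrite lee_fin.
    by rewrite EFinM nnfun_muleindic_ge0.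
  apply: eq_fsbigr => r _.
  (* Pulling the value [r] out of the integral requires it to be nonnegative; a negative [r] is
     never taken, so its level set is empty. *)
  have [r0|r0] := ltP r 0.
    rewrite preimage_nnfun0// measure0 mule0 integral0_eq// => x _.
    by rewrite indicE in_set0 mulr0 mul0e.
  under eq_integral do rewrite EFinM -muleA.
  rewrite ge0_integralZl//; last 2 first.
  + by apply: emeasurable_funM => //; exact/measurable_EFinP.
  + by move=> x _; rewrite mule_ge0 ?lee_fin ?p0.
  congr (_ * _)%E; rewrite nuE// integral_mkcond.
  apply: eq_integral => x _; rewrite patchE indicE.
  by case: (x \in _); rewrite ?mul1e ?mul0e.
rewrite -monotone_convergence//.
- apply: eq_integral => x _; apply/cvg_lim => //.
  apply: cvgeZr => //; exact: cf.
- by move=> n; apply: emeasurable_funM => //; apply/measurable_EFinP.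
- by move=> n x _; rewrite mule_ge0 ?lee_fin ?p0.
- move=> x _ a b ab; apply: lee_wpmul2r; first by rewrite lee_fin p0.
  by rewrite lee_fin; exact/lefP/nd_nnsfun_approx.
Qed.

End density.

Section second_moment.
Context d (T : measurableType d) (R : realType) (nu : probability T R).
Variable X : T -> R.
Hypotheses (mX : measurable_fun [set: T] X)
  (X2 : (\int[nu]_w (X w ^+ 2)%:E < +oo)%E).

Let integrable_sqr : nu.-integrable [set: T] (fun w => (X w ^+ 2)%:E).
Proof.
apply/integrableP; split; first exact/measurable_EFinP/measurable_funX.
by under eq_integral do rewrite gee0_abs ?lee_fin ?sqr_ge0//.
Qed.

Lemma integrable_of_sqr : nu.-integrable [set: T] (EFin \o X).
Proof.
apply: (@le_integrable _ _ _ _ _ measurableT _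
    (fun w => (1 : R)%:E + (X w ^+ 2)%:E)%E).
- exact/measurable_EFinP.
- move=> w _ /=; rewrite lee_fin [leRHS]ger0_norm ?addr_ge0 ?sqr_ge0//.
  (* This square gives |x| <= x ^ 2 + 1/4. *)
  have := sqr_ge0 (`|X w| - 2^-1); rewrite -(real_normK (num_real (X w))).
  by nra.
- by apply: integrableD => //; exact: finite_measure_integrable_cst.
Qed.

(** The cross term integrates to 0; finiteness of the second moment allows the integral to be
    split. *)
Lemma affine_second_moment (a b : R) : (\int[nu]_w (X w)%:E = 0)%E ->
  (\int[nu]_w ((a + b * X w) ^+ 2)%:E =
   (a ^+ 2)%:E + (b ^+ 2)%:E * \int[nu]_w (X w ^+ 2)%:E)%E.
Proof.
move=> X0; transitivity (\int[nu]_w ((a ^+ 2)%:E +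
    ((2 * a * b)%:E * (X w)%:E + (b ^+ 2)%:E * (X w ^+ 2)%:E)))%E.
  by apply: eq_integral => w _; rewrite -!EFinM -!EFinD; congr EFin; ring.
have iX := integrable_of_sqr.
have iZ1 : nu.-integrable setT (fun w => (2 * a * b)%:E * (X w)%:E)%E.
  exact: integrableZl.
have iZ2 : nu.-integrable setT (fun w => (b ^+ 2)%:E * (X w ^+ 2)%:E)%E.
  exact: integrableZl.
rewrite integralD//=; last 2 first.
- exact: finite_measure_integrable_cst.
- exact: integrableD.
rewrite integralD//= !integralZl//= X0 mule0 add0e.
by rewrite integral_cst// [X in (_ * X + _)%E]probability_setT mule1.
Qed.

End second_moment.

Section gaussian_moments.
Context {R : realType}.
Local Notation mu := (@lebesgue_measure R).

Lemma ge0_integral_normal_prob (m s : R) (f : _ -> \bar R) :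
    measurable_fun [set: R] f -> (forall x, 0 <= f x)%E ->
  (\int[normal_prob m s]_x f x =
   \int[mu]_x (f x * (normal_pdf m s x)%:E))%E.
Proof.
move=> mf f0; apply: ge0_integral_density => //.
- exact: measurable_normal_pdf.
- by move=> x; exact: normal_pdf_ge0.
Qed.

Definition normal_second_moment (s : R) : \bar R :=
  \int[normal_prob 0 s]_x (x ^+ 2)%:E.

(* The exact value s ^ 2 is not needed: absorb x ^ 2 into the density of variance
   2 s ^ 2, using y * exp (- y) <= 1. *)
Lemma normal_second_moment_le (s : R) : 0 < s ->
  (normal_second_moment s <= (8 * s ^+ 2)%:E)%E.
Proof.
move=> s0; rewrite /normal_second_moment ge0_integral_normal_prob//; last 2 first.
- by apply/measurable_EFinP; exact: measurable_funX.
- by move=> x; rewrite lee_fin sqr_ge0.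
have r2 : 0 < Num.sqrt 2 :> R by rewrite sqrtr_gt0.
have sn0 : s != 0 by rewrite gt_eqF.
have rsn0 : Num.sqrt 2 * s != 0 by rewrite gt_eqF// mulr_gt0.
have r2sq : (Num.sqrt 2 : R) ^+ 2 = 2 by rewrite sqr_sqrtr.
apply: (@le_trans _ _
  (\int[mu]_x ((8 * s ^+ 2)%:E * (normal_pdf 0 (Num.sqrt 2 * s) x)%:E))%E).
  apply: ge0_le_integral => //.
  - by move=> x _; rewrite mule_ge0// lee_fin ?sqr_ge0 ?normal_pdf_ge0.
  - apply: emeasurable_funM; first by apply/measurable_EFinP; exact: measurable_funX.
    by apply/measurable_EFinP; exact: measurable_normal_pdf.
  - apply: emeasurable_funM => //.
    by apply/measurable_EFinP; exact: measurable_normal_pdf.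
  move=> x _; rewrite -!EFinM lee_fin !normal_pdfE//.
  have -> : normal_peak s = Num.sqrt 2 * normal_peak (Num.sqrt 2 * s).
    rewrite /normal_peak (_ : (Num.sqrt 2 * s) ^+ 2 * pi *+ 2 =
      Num.sqrt 2 ^+ 2 * (s ^+ 2 * pi *+ 2)); last by ring.
    by rewrite [X in _ * X^-1]sqrtrM ?sqr_ge0// sqrtr_sqr gtr0_norm// invfM
      mulrA divff ?mul1r// gt_eqF.
  set k := normal_peak _; have k0 : 0 <= k by exact: normal_peak_ge0.
  rewrite /normal_fun !subr0 exprMn r2sq.
  (* With this [y] the Gaussian exponent is - 2 y: one factor exp (- y) absorbs [y], the other
     belongs to the density of standard deviation sqrt 2 * s. What remains is the constant 4 * sqrt
     2, at most 8. *)
  pose y := x ^+ 2 / (4 * s ^+ 2).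
  have y0 : 0 <= y by rewrite divr_ge0 ?sqr_ge0// mulr_ge0 ?sqr_ge0.
  have -> : - x ^+ 2 / (s ^+ 2 *+ 2) = - y - y by rewrite /y; field.
  have -> : - x ^+ 2 / ((2 * s ^+ 2) *+ 2) = - y by rewrite /y; field.
  have -> : x ^+ 2 = 4 * s ^+ 2 * y by rewrite /y; field.
  rewrite expRD.
  have ye : y * expR (- y) <= 1.
    rewrite expRN ler_pdivrMr ?expR_gt0// mul1r.
    by rewrite (le_trans _ (expR_ge1Dx _))// lerDr.
  have r22 : (Num.sqrt 2 : R) <= 2.
    by have := ltW r2; move: r2sq; nra.
  set e := expR (- y) in ye *; have e0 : 0 <= e by exact: expR_ge0.
  have -> : 4 * s ^+ 2 * y * (Num.sqrt 2 * k * (e * e)) =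
    4 * (Num.sqrt 2 * (y * e)) * (s ^+ 2 * (k * e)) by ring.
  have -> : 8 * s ^+ 2 * (k * e) = 4 * (2 * 1) * (s ^+ 2 * (k * e)) by ring.
  apply: ler_wpM2r; first by rewrite mulr_ge0 ?sqr_ge0// mulr_ge0.
  apply: ler_wpM2l => //; apply: ler_pM => //.
  exact: mulr_ge0.
rewrite ge0_integralZl//.
- by rewrite integral_normal_pdf mule1.
- by apply/measurable_EFinP; exact: measurable_normal_pdf.
- by move=> x _; rewrite lee_fin normal_pdf_ge0.
- by rewrite lee_fin mulr_ge0// sqr_ge0.
Qed.

Lemma normal_prob_set1 (s x : R) : normal_prob 0 s [set x] = 0%E.
Proof.
have /null_content_dominatesP := @normal_prob_dominates R 0 s.
by apply => //; exact: lebesgue_measure_set1.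
Qed.

(** A zero second moment would concentrate the law at 0, but the law is dominated by Lebesgue
    measure and has no atoms. Positivity later forces [Phi] to have finite second moments at the
    nodes of a partition whose sum is square integrable. *)
Lemma normal_second_moment_gt0 (s : R) : (0 < normal_second_moment s)%E.
Proof.
rewrite lt0e; apply/andP; split; last first.
  by apply: integral_ge0 => x _; rewrite lee_fin sqr_ge0.
apply/eqP => m0.
have mX : measurable_fun [set: R] (fun x : R => (x ^+ 2)%:E).
  by apply/measurable_EFinP; exact: measurable_funX.
have /(ae_eq_integral_abs (normal_prob 0 s) measurableT mX) : 
    (\int[normal_prob 0 s]_x `|(x ^+ 2)%:E| = 0)%E.
  rewrite -[RHS]m0; apply: eq_integral => x _.
  by rewrite gee0_abs// lee_fin sqr_ge0.
move=> [N [mN N0 subN]].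
have : (normal_prob 0 s [set: R] <= normal_prob 0 s N + normal_prob 0 s [set 0%R])%E.
  apply: (le_trans _ (measureU2 _ mN (measurable_set1 (0 : R)))).
  apply: le_measure; rewrite ?inE//; first exact: measurableU.
  move=> x _; have [->|x0] := eqVneq x 0; [by right|left].
  apply: subN => /= /(_ I) [] /eqP.
  by rewrite sqrf_eq0 (negbTE x0).
by rewrite (probability_setT (normal_prob 0 s)) N0 normal_prob_set1 adde0 lee_fin ler10.
Qed.

(** The density is even, so substituting - x for x exchanges the integrals of the positive and
    negative parts. *)
Lemma normal_mean0 (s : R) : 0 < s -> (\int[normal_prob 0 s]_x x%:E = 0)%E.
Proof.
move=> s0; have sn0 : s != 0 by rewrite gt_eqF.
have ix : (normal_prob 0 s).-integrable [set: R] (EFin : R -> \bar R).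
  apply: integrable_of_sqr => //; apply: le_lt_trans (ltry (8 * s ^+ 2)).
  exact: normal_second_moment_le.
have ixn := integrable_funeneg measurableT ix.
have mid : measurable_fun [set: R] (EFin : R -> \bar R) by exact/measurable_EFinP.
have pE (x : R) : normal_pdf 0 s (- x) = normal_pdf 0 s x.
  by rewrite !normal_pdfE///normal_fun /= !subr0 sqrrN.
have cp : continuous (normal_pdf 0 s) by exact: continuous_normal_pdf.
rewrite integralE.
suff -> : (\int[normal_prob 0 s]_x (EFin^\+ x) =
           \int[normal_prob 0 s]_x (EFin^\- x))%E.
  by rewrite subee//; exact: integrable_fin_num.
rewrite !ge0_integral_normal_prob//; last 2 first.
- exact: measurable_funeneg.
- exact: measurable_funepos.
transitivity (\int[mu]_(x in `[0%R, +oo[) (x * normal_pdf 0 s x)%:E)%E.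
  rewrite [RHS]integral_mkcond; apply: eq_integral => x _.
  rewrite patchE mem_setE in_itv/= andbT funeposE.
  case: ifPn => [x0|]; first by rewrite -EFin_max -EFinM max_l.
  by rewrite -ltNge => x0; rewrite -EFin_max max_r ?mul0e// ltW.
transitivity (\int[mu]_(x in `]-oo, 0%R]) (- x * normal_pdf 0 s x)%:E)%E.
  rewrite -[X in `]-oo, X]]oppr0 ge0_integration_by_substitutionNy.
  - by apply: eq_integral => x _ /=; rewrite opprK pE.
  - apply: continuous_subspaceT => x; apply: cvgM; last exact: cp.
    exact: (@cvgN _ R^o).
  - move=> x; rewrite in_itv/= oppr0 => x0.
    by rewrite mulr_ge0 ?normal_pdf_ge0// oppr_ge0 ltW.
rewrite [LHS]integral_mkcond; apply: eq_integral => x _.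
rewrite patchE mem_setE in_itv/= funenegE -EFinN.
case: ifPn => [x0|]; first by rewrite -EFin_max -EFinM max_l// oppr_ge0.
by rewrite -ltNge => x0; rewrite -EFin_max max_r ?mul0e// oppr_le0 ltW.
Qed.

End gaussian_moments.

(** * Independence of increments from the past *)

Section independence_from_sets.
Context d (T : measurableType d) (R : realType) (P : probability T R).

Lemma ae_eq_probability (A A' : set T) : measurable A -> measurable A' ->
  {ae P, forall w, A w <-> A' w} -> P A = P A'.
Proof.
have half C C' : measurable C -> measurable C' ->
    {ae P, forall w, C w <-> C' w} -> (P C <= P C')%E.
  move=> mC mC' [N [mN N0 subN]].
  rewrite -[leRHS]adde0 -N0; apply: (le_trans _ (measureU2 P mC' mN)).
  apply: le_measure; rewrite ?inE//; first exact: measurableU.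
  move=> w Cw; have [C'w|C'w] := pselect (C' w); [by left|right].
  by apply: subN => /= -[] /(_ Cw).
move=> mA mA' AA'; apply/eqP; rewrite eq_le !half//.
by apply: filterS AA' => w [? ?]; split.
Qed.

(** Uniqueness of finite measures given on a pi-system: the probability of the intersection with
    [E], and the product with [P E], are both finite measures in [A] that agree on [G] and on the
    whole space. *)
Lemma independent_g_sigma_algebra (G : set_system T) (E : set T) :
    G `<=` measurable -> setI_closed G -> measurable E ->
    (forall A, G A -> P (A `&` E) = P A * P E)%E ->
  forall A, <<s G >> A -> (P (A `&` E) = P A * P E)%E.
Proof.
move=> mG GI mE indepG A GA.
have PEfin : P E \is a fin_num by exact: fin_num_measure.
have PE0 : 0 <= fine (P E) by rewrite fine_ge0.
have traceG : [set X | G X /\ X `<=` setT] = G.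
  by apply/seteqP; split => X /= // [].
rewrite muleC -[in RHS](fineK PEfin).
apply: (g_sigma_algebra_measure_unique_trace G setT measurableT _ _
  (mrestr P mE) (mscale (NngNum PE0) P)); rewrite ?traceG//=.
- by rewrite /mrestr/= /mscale/= setTI probability_setT mule1 fineK.
- by move=> B GB; rewrite /mrestr/= /mscale/= indepG// fineK// muleC.
- rewrite /mrestr setTI; apply: (le_lt_trans (probability_le1 P mE)).
  by rewrite ltry.
Qed.

End independence_from_sets.

(** * Independence of an increment from finitely many earlier values *)

Section increments.
Context d (Omega : measurableType d) (R : realType) (P : probability Omega R).
Variables (B : R -> Omega -> R) (hB : brownian_motion P B).

Lemma increment_measurable (s t : R) : 0 <= s -> 0 <= t ->
  measurable_fun [set: Omega] (B t \- B s).
Proof. by move=> s0 t0; apply: measurable_funB; exact: bm_measurable hB _ _. Qed.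

Lemma measurable_increment_event (s t : R) (Y : set R) : 0 <= s -> 0 <= t ->
  measurable Y -> measurable ((B t \- B s) @^-1` Y).
Proof.
by move=> s0 t0 mY; rewrite -[_ @^-1` _]setTI; exact: increment_measurable.
Qed.

(** Rectangles in the first [n] increments: a pi-system generating their sigma-algebra. *)
Definition increment_events (t : nat -> R) (n : nat) : set_system Omega :=
  [set A | exists2 Y : nat -> set R, (forall i, measurable (Y i)) &
    A = \bigcap_(i in `I_n) (B (t i.+1) \- B (t i))%R @^-1` Y i].

Section fixed_times.
Variables (t : nat -> R) (n : nat).
Hypotheses (t0 : t 0%N = 0) (ndt : nondecreasing_seq t).

Let t_ge0 i : 0 <= t i. Proof. by rewrite -t0 ndt. Qed.

Lemma increment_events_measurable : increment_events t n `<=` measurable.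
Proof.
move=> _ [Y mY ->]; apply: fin_bigcap_measurable => // i _.
exact: measurable_increment_event.
Qed.

Lemma increment_events_independent (A : set Omega) (Z : set R) :
    measurable Z -> <<s increment_events t n >> A ->
  (P (A `&` (B (t n.+1) \- B (t n))%R @^-1` Z) =
   P A * P ((B (t n.+1) \- B (t n))%R @^-1` Z))%E.
Proof.
move=> mZ; apply: independent_g_sigma_algebra.
- exact: increment_events_measurable.
- move=> _ _ [Y mY ->] [Y' mY' ->]; exists (fun i => Y i `&` Y' i).
    by move=> i; exact: measurableI.
  by rewrite -bigcapI; apply: eq_bigcapr => i _; rewrite preimage_setI.
- exact: measurable_increment_event.
move=> _ [Y mY ->].
(* Used twice: [C] = [Z] gives the joint probability, [C] = [setT] that of the rectangle alone. *)
have prodE (C : set R) : measurable C ->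
    P (\bigcap_(i in `I_n) (B (t i.+1) \- B (t i))%R @^-1` Y i `&`
       (B (t n.+1) \- B (t n))%R @^-1` C) =
    (\prod_(i < n) P ((B (t i.+1) \- B (t i))%R @^-1` Y i) *
     P ((B (t n.+1) \- B (t n))%R @^-1` C))%E.
  move=> mC; pose V (i : 'I_n.+1) := if (i < n)%N then Y i else C.
  have mV i : measurable (V i) by rewrite /V; case: ifP.
  have := bm_increments_independent hB (n := n.+1) (t_ge0 0) ndt mV.
  rewrite big_ord_recr/= /V ltnn.
  under eq_bigr do rewrite /= ltn_ord.
  move=> <-; congr (P _); apply/seteqP; split => w /=.
    move=> [Yw Cw] i _ /=; case: ltnP => [|ni]; first exact: Yw.
    by have -> : i = n :> nat by apply/eqP; rewrite eqn_leq ni -ltnS ltn_ord.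
  move=> Vw; split; last by have := Vw ord_max I; rewrite /= ltnn.
  move=> i /= ltin; have := Vw (Ordinal (ltnW ltin : i < n.+1)%N) I.
  by rewrite /= ltin.
rewrite prodE//; congr (_ * _)%E.
have := prodE setT measurableT.
by rewrite preimage_setT setIT probability_setT mule1.
Qed.

Lemma increment_events_partial_sum (j : nat) : (j <= n)%N ->
  @measurable_fun _ _ (g_sigma_algebraType (increment_events t n)) R setT
    (fun w => B (t j) w - B 0 w).
Proof.
move=> jn.
have -> : (fun w => B (t j) w - B 0 w) =
    (fun w => \sum_(i < j) (B (t i.+1) w - B (t i) w)).
  apply/funext => w; rewrite -(big_mkord xpredT (fun i => B (t i.+1) w - B (t i) w)).
  by rewrite (telescope_sumr (fun i => B (t i) w))// t0.
apply: measurable_sum => i _ Y mY; rewrite setTI.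
(* A constraint on the single increment [i] is a rectangle with [setT] in all other places. *)
apply: sub_gen_smallest; exists (fun k => if k == i :> nat then Y else setT).
  by move=> k; case: ifP.
apply/seteqP; split => w /= h.
  by move=> k _ /=; case: ifPn => // /eqP ->.
have := h i; rewrite /= eqxx; apply; exact: leq_trans (ltn_ord i) jn.
Qed.

End fixed_times.

(** Sorting the times of [s] and ending with [r] turns the event into one about increments up to
    [r], after which the increment from [r] to [v] is the next one. Values are taken relative to
    [B 0], which is 0 only almost surely. *)
Lemma path_event_independent (s : seq R) (Y : R -> set R) (r v : R) (Z : set R) :
    0 <= r -> r <= v -> (forall u, u \in s -> 0 <= u <= r) ->
    (forall u, measurable (Y u)) -> measurable Z ->
  let A := [set w | forall u, u \in s -> Y u (B u w - B 0 w)] in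
  measurable A /\ (P (A `&` (B v \- B r)%R @^-1` Z) =
                   P A * P ((B v \- B r)%R @^-1` Z))%E.
Proof.
move=> r0 rv s_le mY mZ A.
pose l := rcons (sort <=%R s) r; pose n := size l.
(* The default [v] places [v] right after [r], at index [n.+1], and keeps the sequence constant from
   there on. *)
pose t i := nth v (0 :: l) i.
have l_le u : u \in l -> 0 <= u <= r.
  by rewrite mem_rcons inE mem_sort => /predU1P[->|/s_le//]; rewrite r0 lexx.
have tn : t n = r by rewrite /t /n /l size_rcons/= nth_rcons ltnn eqxx.
have tn1 : t n.+1 = v by rewrite /t /= nth_default.
have ndt : nondecreasing_seq t.
  have sl : sorted <=%R (0 :: l).
    rewrite /= path_sortedE; last exact: le_trans.
    apply/andP; split; first by apply/allP => u /l_le /andP[].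
    rewrite /l sorted_pairwise ?pairwise_rcons; last exact: le_trans.
    rewrite -sorted_pairwise ?sort_le_sorted ?andbT; last exact: le_trans.
    by apply/allP => u; rewrite mem_sort => /s_le /andP[].
  apply/nondecreasing_seqP => i.
  have [ltin|leni] := ltnP i.+1 (size (0 :: l)).
    by apply: (sorted_leq_nth le_trans lexx v sl) => //; rewrite inE// ltnW.
  rewrite /t [leRHS]nth_default//.
  have [ltin|leni'] := ltnP i (size (0 :: l)); last by rewrite nth_default.
  have : nth v (0 :: l) i \in 0 :: l by rewrite mem_nth.
  by rewrite inE => /predU1P[->|/l_le/andP[_ /le_trans]]; [exact: le_trans rv|exact].
have sA : <<s increment_events t n >> A.
  pose F i := if (i < size s)%N
    then [set w | Y (nth 0 s i) (B (nth 0 s i) w - B 0 w)] else setT.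
  rewrite (_ : A = \bigcap_i F i); last first.
    apply/seteqP; split => w /= Aw.
      by move=> i _; rewrite /F; case: ifPn => // ?; apply: Aw; exact: mem_nth.
    move=> u us; have := Aw (index u s) I.
    by rewrite /F index_mem us/= nth_index.
  apply: (@bigcapT_measurable _ (g_sigma_algebraType (increment_events t n))) => i.
  rewrite /F; case: ifPn => [iS|_]; last exact: measurableT.
  set u := nth 0 s i.
  have ul : u \in l by rewrite mem_rcons inE mem_sort mem_nth// orbT.
  have := @increment_events_partial_sum t n erefl (index u l).+1.
  rewrite index_mem => /(_ ul); rewrite /t /= nth_index// => mu.
  by rewrite -[X in measurable X]setTI; exact: mu.
split.
  apply: smallest_sub sA; first exact: sigma_algebra_measurable.
  exact: increment_events_measurable.
by rewrite -tn1 -tn; exact: increment_events_independent.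
Qed.

End increments.

(** * Independence of an increment from the augmented filtration *)

Section filtration.
Context d (Omega : measurableType d) (R : realType) (P : probability Omega R).
Variables (B : R -> Omega -> R) (hB : brownian_motion P B).

Lemma past_independent (r v : R) (A : set Omega) (Z : set R) :
    0 <= r -> r <= v -> measurable Z ->
    <<s past_events B r `|` null_sets P >> A ->
  measurable A /\ (P (A `&` (B v \- B r)%R @^-1` Z) =
                   P A * P ((B v \- B r)%R @^-1` Z))%E.
Proof.
move=> r0 rv mZ sA.
pose path_event (s : seq R) (Y : R -> set R) :=
  [set w | forall u, u \in s -> Y u (B u w - B 0 w)].
(* Working up to null sets makes [H] a pi-system containing the null sets, and
   allows replacing [B u] by the sum of increments [B u - B 0]. *)
pose H := [set C | measurable C /\ exists s Y,
  [/\ forall u, u \in s -> 0 <= u <= r, forall u, measurable (Y u) &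
      {ae P, forall w, C w <-> path_event s Y w}]].
have mH : H `<=` measurable by move=> C [].
have mZr := measurable_increment_event hB r0 (le_trans r0 rv) mZ.
have HI : setI_closed H.
  move=> C C' [mC [s [Y [s_le mY CE]]]] [mC' [s' [Y' [s_le' mY' CE']]]].
  split; first exact: measurableI.
  pose V u := (if u \in s then Y u else setT) `&` (if u \in s' then Y' u else setT).
  exists (s ++ s'), V; split.
  - by move=> u; rewrite mem_cat => /orP[/s_le|/s_le'].
  - by move=> u; apply: measurableI; case: ifP.
  apply: filterS2 CE CE' => w CE CE'; split.
    move=> [/CE Cw /CE' C'w] u _; split; case: ifPn => // us.
      exact: Cw.
    exact: C'w.
  move=> Vw; split.
    apply/CE => u us; have := Vw u; rewrite mem_cat us => /(_ erefl)[].
    by rewrite us.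
  apply/CE' => u us; have := Vw u; rewrite mem_cat us orbT => /(_ erefl)[].
  by rewrite us.
have sH : past_events B r `|` null_sets P `<=` H.
  move=> C [[u [u0 ur [Y mY ->]]]|[mC PC0]].
    split; first by rewrite -[_ @^-1` _]setTI; apply: (bm_measurable hB).
    exists [:: u], (fun=> Y); split => //.
      by move=> x; rewrite inE => /eqP ->; rewrite u0.
    apply: filterS (bm_start hB) => w B0; rewrite /path_event/= B0; split.
      by move=> Yw x; rewrite inE => /eqP ->; rewrite subr0.
    by move=> /(_ u); rewrite inE eqxx subr0; exact.
  (* A null set agrees almost everywhere with the empty event, written as the condition that B 0 - B
     0 lie in the empty set. *)
  split => //; exists [:: 0], (fun=> set0); split => //.
    by move=> x; rewrite inE => /eqP ->; rewrite lexx.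
  exists C; split => // w /=; apply: contra_notP => Cw; split => // h.
  by have := h 0; rewrite inE eqxx => /(_ erefl).
have {}sA : <<s H >> A.
  move: sA; apply: smallest_sub; first exact: smallest_sigma_algebra.
  by move=> C /sH; exact: sub_gen_smallest.
split; first by apply: smallest_sub sA => //; exact: sigma_algebra_measurable.
apply: independent_g_sigma_algebra sA => //.
move=> C [mC [s [Y [s_le mY CE]]]].
have [mD indD] := path_event_independent hB r0 rv s_le mY mZ.
rewrite (ae_eq_probability mC mD CE) -indD.
apply: ae_eq_probability; [exact: measurableI|exact: measurableI|].
by apply: filterS CE => w CE; split => -[/CE].
Qed.

Lemma brownian_filtration_measurable (t : R) : 0 <= t ->
  brownian_filtration P B t `<=` measurable.
Proof.
move=> t0 A FA; have t1 : t < t + 1 by rewrite ltrDl.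
have := FA (t + 1) t1; apply: smallest_sub; first exact: sigma_algebra_measurable.
move=> C [[u [u0 ur [Y mY ->]]]|[mC _] //].
by rewrite -[_ @^-1` _]setTI; apply: (bm_measurable hB).
Qed.

Lemma brownian_filtration_sigma_algebra (t : R) :
  sigma_algebra setT (brownian_filtration P B t).
Proof.
have sa s := smallest_sigma_algebra setT (past_events B s `|` null_sets P).
split.
- by move=> s _; have [] := sa s.
- by move=> A FA s ts; have [_ + _] := sa s; apply; exact: FA.
- by move=> F FF s ts; have [_ _ +] := sa s; apply => n; exact: FF.
Qed.

Lemma brownian_filtration_nondecreasing (s t : R) : s <= t ->
  brownian_filtration P B s `<=` brownian_filtration P B t.
Proof. by move=> st A FA u /= tu; apply: FA; exact: le_lt_trans tu. Qed.

Lemma brownian_filtration_path (s t : R) (Y : set R) : 0 <= s -> s <= t ->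
  measurable Y -> brownian_filtration P B t (B s @^-1` Y).
Proof.
move=> s0 st mY u /= tu; apply: sub_gen_smallest; left.
by exists s; split => //; [exact: le_trans (ltW tu)|exists Y].
Qed.

(** Dominated convergence for indicators: by path continuity they converge wherever the limit
    increment differs from [x], which is almost sure because its normal law has no atoms. *)
Lemma probability_increment_gt_cvg (t v x : R) (r : nat -> R) (C : set Omega) :
    0 <= t -> t < v -> (forall n, 0 <= r n) -> r n @[n --> \oo] --> t ->
    measurable C ->
  P (C `&` (B v \- B (r n))%R @^-1` `]x, +oo[) @[n --> \oo] -->
  P (C `&` (B v \- B t)%R @^-1` `]x, +oo[).
Proof.
move=> t0 tv r0 rt mC; have v0 := le_trans t0 (ltW tv).
have mS s : 0 <= s -> measurable (C `&` (B v \- B s)%R @^-1` `]x, +oo[).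
  move=> s0; apply: measurableI => //.
  by apply: (measurable_increment_event hB) => //; exact: measurable_itv.
have PE s : 0 <= s -> P (C `&` (B v \- B s)%R @^-1` `]x, +oo[) =
    (\int[P]_w (\1_(C `&` (B v \- B s)%R @^-1` `]x, +oo[) w)%:E)%E.
  by move=> s0; rewrite integral_indic ?setIT//; exact: mS.
rewrite PE//; under eq_fun do rewrite PE//.
have := @dominated_convergence _ Omega R P setT measurableT
  (fun n w => (\1_(C `&` (B v \- B (r n))%R @^-1` `]x, +oo[) w)%:E)
  (fun w => (\1_(C `&` (B v \- B t)%R @^-1` `]x, +oo[) w)%:E)
  (EFin \o cst 1).
move=> []//.
- by move=> n; apply/measurable_EFinP; apply: measurable_indic; exact: mS.
- by apply/measurable_EFinP; apply: measurable_indic; exact: mS.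
- have nx : {ae P, forall w, B v w - B t w <> x}.
    exists ((B v \- B t) @^-1` [set x]); split.
    + exact (measurable_increment_event hB t0 v0 (measurable_set1 x)).
    + rewrite (bm_increments_normal hB t0 tv (measurable_set1 x)).
      exact: normal_prob_set1.
    + by move=> w /= /contrapT.
  apply: filterS2 nx (bm_continuous hB) => w nx /subspace_continuousP cB _.
  have {}cB : B v w - B (r n) w @[n --> \oo] --> B v w - B t w.
    apply: cvgB; first exact: cvg_cst.
    have := cB t; rewrite /= in_itv/= t0 => /(_ isT); apply: cvg_trans.
    apply: (cvg_comp r (fun u => B u w)); last exact: cvg_id.
    move=> U /rt; apply: (@filterS nat \oo
      _ (fun n => `[0, +oo[%classic (r n) -> U (r n))) => n; apply.
    by rewrite /= in_itv/= r0.
  apply: cvg_near_cst.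
  have [xlt|xge] := ltP x (B v w - B t w).
    near=> n; congr EFin; rewrite !indicE; congr (nat_of_bool _)%:R.
    apply/idP/idP; rewrite !inE/= !in_itv/= !andbT => -[Cw _]; split => //.
    by near: n; exact: cvgr_gt cB _ xlt.
  have xgt : B v w - B t w < x by rewrite lt_neqAle xge andbT; apply/eqP.
  near=> n; congr EFin; rewrite !indicE; congr (nat_of_bool _)%:R.
  apply/idP/idP; rewrite !inE/= !in_itv/= !andbT => -[Cw].
    suff : B v w - B (r n) w < x by move=> /ltW; rewrite leNgt => /negbTE ->.
    by near: n; exact: cvgr_lt cB _ xgt.
  by rewrite ltNge (ltW xgt).
- exact: finite_measure_integrable_cst.
- apply: aeW => w n _ /=; rewrite ger0_norm// lee_fin.
  by rewrite indicE; case: (_ \in _).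
Unshelve. all: by end_near. Qed.

(** An event of F_t lies in the augmented past of every r in ]t, v], hence is independent of B v - B
    r. Letting r decrease to t preserves the product rule on open rays, which form a pi-system
    generating the Borel sets. *)
Lemma filtration_independent (t v : R) (A : set Omega) (Z : set R) :
    0 <= t -> t < v -> measurable Z -> brownian_filtration P B t A ->
  (P (A `&` (B v \- B t)%R @^-1` Z) = P A * P ((B v \- B t)%R @^-1` Z))%E.
Proof.
move=> t0 tv mZ FA; have v0 := le_trans t0 (ltW tv).
have mA := brownian_filtration_measurable t0 FA.
(* Times in ]t, v] decreasing to [t], starting from [r 0] = [v]. *)
pose r n := t + (v - t) / n.+1%:R.
have tr n : t < r n by rewrite ltrDl divr_gt0// subr_gt0.
have r0 n : 0 <= r n by exact: le_trans (ltW (tr n)).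
have rv n : r n <= v.
  by rewrite -lerBrDl ler_pdivrMr// ler_peMr ?subr_ge0 ?(ltW tv)// ler1n.
have rt : r n @[n --> \oo] --> t.
  rewrite -[X in _ --> X]addr0; apply: cvgD; first exact: cvg_cst.
  rewrite -[X in _ --> X](mulr0 (v - t)); apply: cvgM; first exact: cvg_cst.
  exact: cvg_harmonic.
have indep_ray x : (P (A `&` (B v \- B t)%R @^-1` `]x, +oo[) =
                    P A * P ((B v \- B t)%R @^-1` `]x, +oo[))%E.
  have PA : P A \is a fin_num by exact: fin_num_measure.
  have c1 := probability_increment_gt_cvg (x := x) t0 tv r0 rt mA.
  have := probability_increment_gt_cvg (x := x) t0 tv r0 rt measurableT.
  rewrite setTI; under eq_fun do rewrite setTI; move=> /(cvgeZl PA) c2.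
  rewrite -(cvg_lim _ c1)// -(cvg_lim _ c2)//; congr (limn _); apply/funext => n.
  by have [//|_ ->//] := past_independent (Z := `]x, +oo[) (r0 n) (rv n) _ (FA (r n) (tr n)).
pose G := [set (B v \- B t) @^-1` `]x, +oo[ | x in setT].
have mG : G `<=` measurable.
  move=> _ [x _ <-].
  by apply: (measurable_increment_event hB) => //; exact: measurable_itv.
(* The roles are exchanged: the pi-system is now on the side of the increment, and [A] is the fixed
   event. *)
rewrite setIC muleC; apply: (@independent_g_sigma_algebra _ _ _ _ G) => //.
- move=> _ _ [x _ <-] [y _ <-]; exists (Num.max x y) => //.
  rewrite -preimage_setI; congr (_ @^-1` _); apply/seteqP; split => z /=.
    by rewrite !in_itv/= !andbT gt_max => /andP.
  by rewrite !in_itv/= !andbT gt_max => -[-> ->].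
- by move=> _ [x _ <-]; rewrite setIC muleC.
have : @measurable_fun _ _ (g_sigma_algebraType G) R setT (B v \- B t).
  apply: (measurability _ (RGenOInfty.measurableE R)).
  move=> _ [_ [x ->] <-]; rewrite setTI; apply: sub_gen_smallest.
  by exists x.
by move=> /(_ measurableT Z mZ); rewrite setTI.
Qed.

End filtration.

(** * The Ito isometry *)

Section freezing.
Context d (Omega : measurableType d) (R : realType) (P : probability Omega R).
Context d1 (T1 : measurableType d1) d2 (T2 : measurableType d2).
Variables (X : Omega -> T1) (Y : Omega -> T2) (nu : probability T2 R).
Hypotheses (mX : measurable_fun [set: Omega] X)
  (mY : measurable_fun [set: Omega] Y).
Hypothesis XY_independent : forall C D, measurable C -> measurable D ->
  (P (X @^-1` C `&` Y @^-1` D) = P (X @^-1` C) * nu D)%E.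

(** The hypothesis identifies the joint law as the product of the law of [X] and [nu], after which
    Tonelli applies. Its case [C] = [setT] says that [nu] is the law of [Y]. *)
Lemma integral_independent_pair (h : T1 * T2 -> \bar R) :
    measurable_fun [set: T1 * T2] h -> (forall z, 0 <= h z)%E ->
  (\int[P]_w h (X w, Y w) = \int[P]_w \int[nu]_y h (X w, y))%E.
Proof.
move=> mh h0.
have mXY : measurable_fun [set: Omega] (fun w => (X w, Y w)).
  exact: measurable_fun_pair.
pose X' : {RV P >-> T1} := HB.pack X (isMeasurableFun.Build _ _ _ _ _ mX).
pose XY : {RV P >-> (T1 * T2)%type} :=
  HB.pack (fun w => (X w, Y w)) (isMeasurableFun.Build _ _ _ _ _ mXY).
rewrite -(ge0_integral_distribution XY mh h0).
rewrite (eq_measure_integral (distribution P X' \x nu)%E); last first.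
  move=> A mA _; rewrite -(@product_measure_unique _ _ _ _ _
    (distribution P X') nu (distribution P XY))//.
rewrite fubini_tonelli1//.
rewrite (ge0_integral_distribution X')//.
- exact: measurable_fun_fubini_tonelli_F.
- by move=> x; apply: integral_ge0 => y _.
Qed.

End freezing.

Section isometry.
Context d (Omega : measurableType d) (R : realType) (P : probability Omega R).

Definition mean_square (X : Omega -> R) : \bar R := \int[P]_w (X w ^+ 2)%:E.

Lemma mean_square_ge0 (X : Omega -> R) : (0 <= mean_square X)%E.
Proof. by apply: integral_ge0 => w _; rewrite lee_fin sqr_ge0. Qed.

Variables (B : R -> Omega -> R) (hB : brownian_motion P B).
Local Notation F := (brownian_filtration P B).

(** F_t is a sigma-algebra, hence equals the one it generates; the closure properties of
    [measurable_fun] thus become available for F_t-measurability. *)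
Lemma measurable_wrt_filtrationP (t : R) (X : Omega -> R) :
  measurable_wrt (F t) X <->
  @measurable_fun _ _ (g_sigma_algebraType (F t)) R setT X.
Proof.
have sF : <<s F t >> = F t.
  by apply: sigma_algebra_id; exact: brownian_filtration_sigma_algebra.
split=> [FX _ Y mY|mX Y mY].
  by rewrite setTI; apply: sub_gen_smallest; exact: FX.
by rewrite -sF -[_ @^-1` _]setTI; exact: mX.
Qed.

Lemma measurable_wrt_measurable (t : R) (X : Omega -> R) : 0 <= t ->
  measurable_wrt (F t) X -> measurable_fun [set: Omega] X.
Proof.
move=> t0 FX _ Y mY; rewrite setTI.
by apply: (brownian_filtration_measurable hB t0); exact: FX.
Qed.

(** Second moment of a Brownian increment over a time span [h]; the square root turns the variance
    into the standard deviation expected by [normal_prob]. *)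
Definition increment_second_moment (h : R) : \bar R :=
  normal_second_moment (Num.sqrt h).

Lemma increment_second_moment_gt0 (h : R) : (0 < increment_second_moment h)%E.
Proof. exact: normal_second_moment_gt0. Qed.

Lemma increment_second_moment_le (h : R) : 0 < h ->
  (increment_second_moment h <= (8 * h)%:E)%E.
Proof.
move=> h0; have := @normal_second_moment_le R (Num.sqrt h).
by rewrite (sqr_sqrtr (ltW h0)) sqrtr_gt0; exact.
Qed.

(* No integrability is assumed: both sides may be infinite. *)
Lemma mean_square_step (t v : R) (a f : Omega -> R) : 0 <= t -> t < v ->
    measurable_wrt (F t) a -> measurable_wrt (F t) f ->
  (mean_square (fun w => a w + f w * (B v w - B t w))%R =
   mean_square a + mean_square f * increment_second_moment (v - t))%E.
Proof.
move=> t0 tv Fa Ff; have v0 := le_trans t0 (ltW tv).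
have ma := measurable_wrt_measurable t0 Fa.
have mf := measurable_wrt_measurable t0 Ff.
have s0 : 0 < Num.sqrt (v - t) by rewrite sqrtr_gt0 subr_gt0.
have indep C D : measurable C -> measurable D ->
    (P ((fun w => (a w, f w)) @^-1` C `&` (B v \- B t)%R @^-1` D) =
     P ((fun w => (a w, f w)) @^-1` C) * normal_prob 0 (Num.sqrt (v - t)) D)%E.
  move=> mC mD; rewrite -(bm_increments_normal hB t0 tv mD).
  apply: (filtration_independent hB) => //.
  have sF : <<s F t >> = F t.
    by apply: sigma_algebra_id; exact: brownian_filtration_sigma_algebra.
  have : @measurable_fun _ _ (g_sigma_algebraType (F t)) _ setT
      (fun w => (a w, f w)).
    by apply: measurable_fun_pair; exact/measurable_wrt_filtrationP.
  by move=> /(_ measurableT C mC); rewrite setTI -[X in _ -> X _]sF.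
pose h (z : (R * R) * R) := ((z.1.1 + z.1.2 * z.2) ^+ 2)%:E.
have mh : measurable_fun [set: (R * R) * R] h.
  apply/measurable_EFinP; apply: measurable_funX; apply: measurable_funD.
    exact: measurableT_comp.
  by apply: measurable_funM => //; exact: measurableT_comp.
have h0 z : (0 <= h z)%E by rewrite lee_fin sqr_ge0.
have mp : measurable_fun [set: Omega] (fun w => (a w, f w)).
  exact: measurable_fun_pair.
have := integral_independent_pair (nu := normal_prob 0 (Num.sqrt (v - t)))
  mp (increment_measurable hB t0 v0) indep mh h0.
rewrite /mean_square /h/= => ->.
have m2y : (increment_second_moment (v - t) < +oo)%E.
  by rewrite (le_lt_trans (increment_second_moment_le _)) ?ltry// subr_gt0.
(* With [a] and [f] frozen, the inner integrand is the square of an affine function of a centered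
   normal variable. *)
transitivity (\int[P]_w ((a w ^+ 2)%:E +
    (f w ^+ 2)%:E * increment_second_moment (v - t)))%E.
  apply: eq_integral => w _.
  by rewrite affine_second_moment//; exact: normal_mean0.
rewrite ge0_integralD//=; last 4 first.
- by move=> w _; rewrite lee_fin sqr_ge0.
- exact/measurable_EFinP/measurable_funX.
- move=> w _; rewrite mule_ge0 ?lee_fin ?sqr_ge0//.
  exact/ltW/increment_second_moment_gt0.
- apply: emeasurable_funM => //; exact/measurable_EFinP/measurable_funX.
rewrite ge0_integralZr//.
- exact/measurable_EFinP/measurable_funX.
- by move=> w _; rewrite lee_fin sqr_ge0.
- exact/ltW/increment_second_moment_gt0.
Qed.

(** Induction on [n]: the partial sum is measurable with respect to F at time [t n], so that adding
    the last increment is one use of [mean_square_step]. *)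
Lemma mean_square_martingale_sum (n : nat) (t : nat -> R) (f : nat -> Omega -> R) :
    0 <= t 0%N -> (forall i, (i < n)%N -> t i < t i.+1) ->
    (forall i, (i < n)%N -> measurable_wrt (F (t i)) (f i)) ->
  (mean_square (fun w => \sum_(i < n) f i w * (B (t i.+1) w - B (t i) w))%R =
   \sum_(i < n) mean_square (f i) * increment_second_moment (t i.+1 - t i))%E.
Proof.
elim: n => [|n IHn] t0 tS Ff.
  rewrite big_ord0 /mean_square; apply: integral0_eq => w _.
  by rewrite big_ord0 expr0n.
have t_le i j : (i <= j)%N -> (j <= n)%N -> t i <= t j.
  elim: j => [|j IHj]; first by rewrite leqn0 => /eqP ->.
  rewrite leq_eqVlt => /predU1P[->//|ij jn].
  by rewrite (le_trans (IHj ij (ltnW jn)))// ltW// tS// ltnW.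
have tn0 : 0 <= t n by rewrite (le_trans t0)// t_le.
rewrite big_ord_recr/= -IHn//; last 2 first.
- by move=> i ltin; apply: tS; exact: ltnW.
- by move=> i ltin; apply: Ff; exact: ltnW.
rewrite -mean_square_step//; last 3 first.
- exact: tS.
- apply/measurable_wrt_filtrationP; apply: measurable_sum => i.
  have sub j : (j <= n)%N -> @measurable_fun _ _ (g_sigma_algebraType (F (t n))) R setT (B (t j)).
    move=> jn; apply/measurable_wrt_filtrationP => Y mY.
    apply: brownian_filtration_path => //; last exact: t_le.
    by rewrite (le_trans t0)// t_le.
  apply: measurable_funM; last first.
    by apply: measurable_funB; apply: sub => //; exact: ltnW.
  apply/measurable_wrt_filtrationP => Y mY.
  apply: (brownian_filtration_nondecreasing (t_le i n (ltnW (ltn_ord i)) (leqnn n))).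
  by apply: Ff => //; rewrite ltnS ltnW.
- exact: Ff.
by congr mean_square; apply/funext => w; rewrite big_ord_recr.
Qed.

End isometry.

(** * Partitions and Riemann sums *)

Section partitions.
Context {R : realType}.
Implicit Types (x y a b e T : R) (s l : seq R).

(** Merging strict increase with the bound on the step makes a partition of mesh below [e] a single
    [path], which can be cut and glued. *)
Definition fine_step e : rel R := fun x y => (x < y) && (y - x < e).

Lemma fine_partitionP e T s : 0 < e ->
  (itv_partition 0 T s /\ mesh s < e) <-> (path (fine_step e) 0 s /\ last 0 s = T).
Proof.
move=> e0.
have meshE : mesh s < e <-> path (fun x y => y - x < e) 0 s.
  split=> [/bigmax_ltP[_ sP]|/(pathP 0) sP].
    by apply/(pathP 0) => i iS; have := sP (Ordinal iS) isT.
  by apply/bigmax_ltP; split => // i _; exact: sP.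
split=> [[[ps /eqP lT] /meshE ms]|[ps lT]].
  split=> //; apply/(pathP 0) => i iS; apply/andP; split.
    exact: (pathP 0 ps).
  exact: (pathP 0 ms).
split; first split; last 2 first.
- exact/eqP.
- by apply/meshE; apply: sub_path ps => x y /andP[].
- by apply: sub_path ps => x y /andP[].
Qed.

Lemma fine_partition_exists e T : 0 < e -> 0 < T ->
  exists2 s, itv_partition 0 T s & mesh s < e.
Proof.
move=> e0 T0.
suff [s [ps sT]] : exists s, path (fine_step e) 0 s /\ last 0 s = T.
  by have [_ /(_ (conj ps sT))[]] := fine_partitionP T s e0; exists s.
have e20 : 0 < e / 2 by rewrite divr_gt0.
have [n Tn] : exists n, T - 0 < n%:R * (e / 2).
  by exists (Num.truncn (T / (e / 2))).+1; rewrite subr0 -ltr_pdivrMr// truncnS_gt.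
(* The starting point is generalized from 0; each step of length e / 2 lowers [n] by one, until the
   remaining distance is below [e]. *)
elim: n 0 T0 Tn => [|n IHn] x xT; first by rewrite mul0r subr_lt0 ltNge ltW.
rewrite -natr1 mulrDl mul1r => Txn.
have [Tx|Tx] := ltP (T - x) e.
  by exists [:: T]; rewrite /= /fine_step xT Tx.
have xyT : x + e / 2 < T by lra.
have [//||s [ps lT]] := IHn (x + e / 2); first by lra.
exists (x + e / 2 :: s); rewrite /= lT; split => //; apply/andP; split => //.
by rewrite /fine_step; apply/andP; split; lra.
Qed.

Section node.
Variables (T : R) (s : seq R) (i : nat).
Hypotheses (sP : itv_partition 0 T s) (iS : (i < size s)%N).

Lemma node_lt : node s i < node s i.+1.
Proof. by case: sP => /(pathP 0) ps _; exact: ps. Qed.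

Lemma node_ge0 : 0 <= node s i.
Proof.
have iS' : (i < (size s).+1)%N by rewrite ltnS ltnW.
rewrite /node (set_nth_default T)//; exact: itv_partition_nth_ge sP.
Qed.

Lemma node_le : node s i.+1 <= T.
Proof.
rewrite /node (set_nth_default T)//; apply: (@itv_partition_nth_le _ _ 0 T s i.+1) => //.
Qed.

Lemma node_step_lt_mesh e : mesh s < e -> node s i.+1 - node s i < e.
Proof. by move=> /bigmax_ltP[_ /(_ (Ordinal iS) isT)]. Qed.

End node.

(** The bound x < T excludes the final node, so [x] is the left endpoint of an interval. *)
Lemma node_index T s x : itv_partition 0 T s -> x \in 0 :: s -> x < T ->
  exists2 i, (i < size s)%N & x = node s i.
Proof.
move=> [_ /eqP lT] xs xT; have := xs; rewrite -index_mem /= ltnS => ix.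
exists (index x (0 :: s)); last by rewrite /node nth_index.
rewrite ltn_neqAle ix andbT; apply: contraTN xT => /eqP xE.
by rewrite -(nth_index 0 xs) xE -lT -leNgt (last_nth 0).
Qed.

Lemma fine_path_all_lt e x l : path (fine_step e) x l -> all (> x) l.
Proof.
move=> pl; apply: (order_path_min lt_trans).
by apply: sub_path pl => y z /andP[].
Qed.

(** The node following the last one below [a] is at least [a], so the step to [a] is no longer than
    a step of the path. *)
Lemma fine_path_below e x l a : path (fine_step e) x l -> x < a -> a <= last x l ->
  let s := [seq y <- l | y < a] in
  path (fine_step e) x s /\ fine_step e (last x s) a.
Proof.
elim: l x => [x _ xa /le_lt_trans/(_ xa)|y l IHl x /=]; first by rewrite ltxx.
move=> /andP[xy pl] xa al; have [ya|ay] := ltP y a; first by rewrite /= xy; exact: IHl.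
rewrite (_ : [seq _ <- l | _] = [::]); last first.
  rewrite (eq_in_filter (a2 := pred0)) ?filter_pred0// => z zl.
  have /allP/(_ z zl) yz := fine_path_all_lt pl.
  by apply/negbTE; rewrite -leNgt (le_trans ay)// ltW.
split => //; rewrite /= /fine_step xa/=.
by case/andP: xy => _; apply: le_lt_trans; rewrite lerB.
Qed.

(** The first node beyond [b] is preceded by a node at most [b], so starting from [b] does not
    lengthen that step. *)
Lemma fine_path_above e x l b : path (fine_step e) x l -> x <= b -> b <= last x l ->
  let s := [seq y <- l | b < y] in
  path (fine_step e) b s /\ last b s = last x l.
Proof.
elim: l x => [x _ xb bx|y l IHl x /=]; first by split => //; apply/le_anti; rewrite bx xb.
move=> /andP[xy pl] xb bl; have [b_y|yb] := ltP b y; last exact: IHl.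
rewrite (_ : [seq _ <- l | _] = l).
  rewrite /= pl andbT; split => //; rewrite /fine_step b_y/=.
  by case/andP: xy => _; apply: le_lt_trans; rewrite lerB.
rewrite (eq_in_filter (a2 := predT)) ?filter_predT// => z zl.
have /allP/(_ z zl) yz := fine_path_all_lt pl.
exact: lt_trans yz.
Qed.

Lemma mesh_cvg0P T (g : seq R -> \bar R) : (forall s, (0 <= g s)%E) ->
  (g s @[s --> mesh_to0 T] --> 0%E) <->
  (forall e, 0 < e -> exists2 r, 0 < r &
    forall s, itv_partition 0 T s -> mesh s < r -> (g s < e%:E)%E).
Proof.
move=> g0; split=> [cg e e0|gP U].
  have /cg[r /= r0 rP] : nbhs 0%E [set x : \bar R | (x < e%:E)%E].
    by apply: open_nbhs_nbhs; split; [exact: open_ereal_lt_ereal|rewrite /= lte_fin].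
  by exists r => // s sP sr; apply: rP.
rewrite -[nbhs _ _]/(nbhs 0%:E U) => /nbhs_EFin /nbhs_ballP[e /= e0 eU].
have [r r0 rP] := gP e e0; exists r => // s /= [sP sr].
have := rP s sP sr; have := g0 s; case: (g s) => [x| |]//=.
rewrite lee_fin lte_fin => x0 xe; apply: eU.
by rewrite /ball/= sub0r normrN ger0_norm.
Qed.

End partitions.

(** * Riemann sums by recursion on the partition *)

Section riemann_sums.
Context d (Omega : measurableType d) (R : realType).
Variables (B : R -> Omega -> R).

(** Carrying the current left endpoint [x] lets the sum split along a concatenation of lists of
    nodes. *)
Fixpoint riemann_sum (Phi : R -> Omega -> R) (x : R) (s : seq R) (w : Omega) : R :=
  if s is y :: s' then Phi x w * (B y w - B x w) + riemann_sum Phi y s' w else 0.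

Lemma riemann_sum_cat Phi x s s' w :
  riemann_sum Phi x (s ++ s') w =
  riemann_sum Phi x s w + riemann_sum Phi (last x s) s' w.
Proof. by elim: s x => [|y s IHs] x /=; rewrite ?add0r// IHs addrA. Qed.

Lemma stochastic_sumE Phi s w :
  stochastic_sum B Phi [set: 'I_(size s)]%SET w = riemann_sum Phi 0 s w.
Proof.
rewrite /stochastic_sum; under eq_bigl do rewrite finset.in_setT.
have -> : node s = nth 0 (0 :: s) by [].
suff sumE x : \sum_(i < size s) Phi (nth 0 (x :: s) i) w *
    (B (nth 0 (x :: s) i.+1) w - B (nth 0 (x :: s) i) w) =
    riemann_sum Phi x s w by exact: sumE.
elim: s x => [|y s IHs] x; first by rewrite /= big_ord0.
by rewrite /= big_ord_recl -IHs.
Qed.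

End riemann_sums.

(** * Inequalities for second moments *)

Section mean_square.
Context d (Omega : measurableType d) (R : realType) (P : probability Omega R).
Implicit Types X Y : Omega -> R.

Lemma mean_squareD_le X Y : measurable_fun setT X -> measurable_fun setT Y ->
  (mean_square P (X \+ Y)%R <=
   2%:E * mean_square P X + 2%:E * mean_square P Y)%E.
Proof.
move=> mX mY; have m2 (Z : Omega -> R) : measurable_fun setT Z ->
    measurable_fun [set: Omega] (fun w => (Z w ^+ 2)%:E).
  by move=> mZ; exact/measurable_EFinP/measurable_funX.
have m2' (Z : Omega -> R) : measurable_fun setT Z ->
    measurable_fun [set: Omega] (fun w => 2%:E * (Z w ^+ 2)%:E)%E.
  by move=> mZ; apply: emeasurable_funM => //; exact: m2.
have sq (Z : Omega -> R) w : (0 <= (Z w ^+ 2)%:E :> \bar R)%E by rewrite lee_fin sqr_ge0.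
rewrite -!ge0_integralZl_EFin//; [|exact: m2|exact: m2].
rewrite -ge0_integralD//; last 4 first.
- by move=> w _; rewrite mule_ge0.
- exact: m2'.
- by move=> w _; rewrite mule_ge0.
- exact: m2'.
apply: ge0_le_integral => //.
- by apply: m2; exact: measurable_funD.
- by apply: emeasurable_funD; exact: m2'.
move=> w _; rewrite -!EFinM -EFinD lee_fin.
by have := sqr_ge0 (X w - Y w); rewrite !expr2/=; nra.
Qed.

Lemma mean_squareN X : mean_square P (\- X)%R = mean_square P X.
Proof. by apply: eq_integral => w _ /=; rewrite sqrrN. Qed.

Lemma mean_squareB_le X Y : measurable_fun setT X -> measurable_fun setT Y ->
  (mean_square P (X \- Y)%R <=
   2%:E * mean_square P X + 2%:E * mean_square P Y)%E.
Proof.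
move=> mX mY; rewrite -(mean_squareN Y); apply: mean_squareD_le => //.
exact: measurableT_comp.
Qed.

Lemma mean_square_lty X : X \in Lfun P 2%:E -> (mean_square P X < +oo)%E.
Proof.
move=> /Lfun2_integrable_sqr /integrableP[_]; apply: le_lt_trans.
rewrite /mean_square le_eqVlt; apply/predU1P; left; apply: eq_integral => w _ /=.
by rewrite ger0_norm// sqr_ge0.
Qed.

Lemma Lfun_measurable X : X \in Lfun P 2%:E -> measurable_fun [set: Omega] X.
Proof. by move=> /sub_Lfun_mfun; rewrite inE. Qed.

End mean_square.

(** * Removing finitely many terms *)

Section adapted_integrands.
Context d (Omega : measurableType d) (R : realType) (P : probability Omega R).
Variables (B : R -> Omega -> R) (hB : brownian_motion P B) (T : R).
Hypothesis T0 : 0 < T.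
Local Notation F := (brownian_filtration P B).
Local Notation ms := (mean_square P).
Local Notation m2 := increment_second_moment.

Variables (Phi : R -> Omega -> R).
Hypothesis aPhi : adapted F Phi.

Lemma adapted_measurable (t : R) : 0 <= t -> measurable_fun [set: Omega] (Phi t).
Proof. by move=> t0; apply: (measurable_wrt_measurable hB t0); exact: aPhi. Qed.

Lemma stochastic_sum_measurable (s : seq R) (J : {set 'I_(size s)}) :
  itv_partition 0 T s -> measurable_fun [set: Omega] (stochastic_sum B Phi J).
Proof.
move=> sP; rewrite /stochastic_sum.
under eq_fun do rewrite big_mkcond/=.
apply: measurable_sum => j; case: (j \in J); last exact: measurable_cst.
have j0 := node_ge0 sP (ltn_ord j).
have j1 : 0 <= node s j.+1 by rewrite (le_trans j0)// ltW// (node_lt sP).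
apply: measurable_funM; first exact: adapted_measurable.
exact: (increment_measurable hB j0 j1).
Qed.

(** The Ito isometry for a partial sum: coefficients outside [J] are replaced by 0, which keeps each
    coefficient measurable at its node. *)
Lemma mean_square_stochastic_sum (s : seq R) (J : {set 'I_(size s)}) :
    itv_partition 0 T s ->
  (ms (stochastic_sum B Phi J) =
   \sum_(j in J) ms (Phi (node s j)) * m2 (node s j.+1 - node s j))%E.
Proof.
move=> sP; pose c (i : nat) := [exists j in J, j == i :> nat].
have cE (j : 'I_(size s)) : c j = (j \in J).
  apply/exists_inP/idP => [[k kJ /eqP/val_inj <-]//|jJ]; by exists j.
pose f i w := if c i then Phi (node s i) w else 0.
have fE j : f (nat_of_ord j) = if j \in J then Phi (node s j) else cst 0.
  by apply/funext => w; rewrite /f cE; case: ifP.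
have := mean_square_martingale_sum hB (n := size s) (t := node s) (f := f).
rewrite {1}/node/= lexx => /(_ isT) sumE.
transitivity (ms (fun w => \sum_(i < size s) f i w *
    (B (node s i.+1) w - B (node s i) w))%R).
  congr mean_square; apply/funext => w; rewrite /stochastic_sum big_mkcond/=.
  by apply: eq_bigr => j _; rewrite fE; case: ifP => // _; rewrite mul0r.
rewrite sumE; last 2 first.
- by move=> i iS; exact: node_lt sP iS.
- move=> i iS; rewrite /f; case: (c i); first by apply: aPhi; exact: node_ge0 sP iS.
  by apply/measurable_wrt_filtrationP; exact: measurable_cst.
rewrite [RHS]big_mkcond/=; apply: eq_bigr => j _; rewrite fE; case: ifP => // _.
rewrite /mean_square integral0_eq ?mul0e// => w _.
by rewrite expr0n.
Qed.

Lemma mean_square_term (t v : R) (f : Omega -> R) : 0 <= t -> t < v ->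
    measurable_wrt (F t) f ->
  (ms (fun w => f w * (B v w - B t w))%R = ms f * m2 (v - t))%E.
Proof.
move=> t0 tv Ff; have := mean_square_step hB (a := cst 0) t0 tv _ Ff.
rewrite {2}/mean_square integral0_eq ?add0e; last by move=> w _; rewrite expr0n.
move=> <-; first by congr mean_square; apply/funext => w; rewrite add0r.
by apply/measurable_wrt_filtrationP; exact: measurable_cst.
Qed.

Section ito_integrable.
Variable X : Omega -> R.
Hypothesis IX : is_ito_integral P B T Phi X.

Let S s := stochastic_sum B Phi [set: 'I_(size s)]%SET.

Let mX : measurable_fun [set: Omega] X.
Proof. by apply: (@Lfun_measurable _ _ _ P); case: IX. Qed.

Let mS s : itv_partition 0 T s -> measurable_fun [set: Omega] (S s).
Proof. exact: stochastic_sum_measurable. Qed.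

Lemma ito_integral_cvg e : 0 < e -> exists2 r, 0 < r &
  forall s, itv_partition 0 T s -> mesh s < r -> (ms (S s \- X)%R < e%:E)%E.
Proof.
case: IX => _; rewrite unlock.
move=> /mesh_cvg0P cX; apply: cX => s.
by apply: integral_ge0 => w _; rewrite lee_fin sqr_ge0.
Qed.

(** A sum within distance 1 of [X] in mean square has a finite second moment. By the isometry this
    moment is a sum of nonnegative terms in which each moment of [Phi] has a positive weight, so
    none of them is infinite. *)
Lemma fine_partition_moments e : 0 < e ->
  exists2 s, itv_partition 0 T s /\ mesh s < e &
  exists2 M, 0 <= M &
    forall i, (i < size s)%N -> (ms (Phi (node s i)) <= M%:E)%E.
Proof.
move=> e0; have [r r0 rP] := ito_integral_cvg ltr01.
have re0 : 0 < Num.min r e by rewrite lt_min r0.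
have [s sP] := fine_partition_exists re0 T0; rewrite lt_min => /andP[sr se].
exists s => //.
have Sfin : (ms (S s) < +oo)%E.
  have -> : S s = ((S s \- X) \+ X)%R by apply/funext => w /=; rewrite subrK.
  apply: (le_lt_trans (mean_squareD_le P _ mX)).
    by apply: measurable_funB => //; exact: mS.
  apply: lte_add_pinfty; rewrite lte_mul_pinfty//.
    by rewrite (lt_trans (rP s sP sr)) ?ltry.
  by apply: mean_square_lty; case: IX.
have term_fin (i : 'I_(size s)) : (ms (Phi (node s i)) < +oo)%E.
  rewrite ltNge leye_eq; apply/negP => /eqP msy.
  move: Sfin; rewrite mean_square_stochastic_sum//= (bigD1 i) ?finset.in_setT//= msy.
  rewrite gt0_mulye ?increment_second_moment_gt0// addye ?ltxx//.
  rewrite gt_eqF//; apply: (lt_le_trans (ltNyr 0)).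
  apply: sume_ge0 => j _; apply: mule_ge0; first exact: mean_square_ge0.
  exact/ltW/increment_second_moment_gt0.
exists (\sum_(i < size s) fine (ms (Phi (node s i)))).
  by apply: sumr_ge0 => i _; rewrite fine_ge0// mean_square_ge0.
move=> i iS; pose j := Ordinal iS.
rewrite -[X in (X <= _)%E]fineK; last first.
  by rewrite ge0_fin_numE ?mean_square_ge0// (term_fin j).
rewrite lee_fin (bigD1 j)//= lerDl; apply: sumr_ge0 => k _.
by rewrite fine_ge0// mean_square_ge0.
Qed.

(* Inserting the nodes [a < b] in a reference partition [s], or only [b], gives
   two Riemann sums which differ by one increment over [[a, b]]. *)
Lemma riemann_sum_insert s r a b :
    itv_partition 0 T s -> mesh s < r -> 0 < a -> a < b -> b <= T -> b - a < r ->
  exists p s1 s2, [/\ p \in 0 :: s, p < a,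
    itv_partition 0 T s1 /\ mesh s1 < r + r,
    itv_partition 0 T s2 /\ mesh s2 < r + r &
    forall w, S s1 w - S s2 w = (Phi a w - Phi p w) * (B b w - B a w)].
Proof.
move=> sP sr a0 ab bT bar; have r0 : 0 < r by apply: lt_trans bar; rewrite subr_gt0.
have [ps lT] := (fine_partitionP T s r0).1 (conj sP sr).
have aT : a <= last 0 s by rewrite lT (le_trans (ltW ab)).
have [ppre] := fine_path_below ps a0 aT.
set pre := [seq y <- s | y < a]; set p := last 0 pre => /andP[pa apr].
have bl : b <= last 0 s by rewrite lT.
have [ppost lpost] := fine_path_above ps (ltW (lt_trans a0 ab)) bl.
set post := [seq y <- s | b < y] in ppost lpost.
have widen x l : path (fine_step r) x l -> path (fine_step (r + r)) x l.
  apply: sub_path => y z /andP[yz zyr]; rewrite /fine_step yz/=.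
  by rewrite (lt_trans zyr)// ltrDl.
have rr0 : 0 < r + r by rewrite addr_gt0.
(* Nodes of [s] within [a, b] are dropped; the first partition gets both [a] and [b], the second
   only [b]. The longest new step is from [p] to [b], of length (a - p) + (b - a) < r + r. *)
exists p, (pre ++ [:: a, b & post]), (pre ++ b :: post); split => //.
- have := mem_last 0 pre; rewrite -/p !inE => /orP[->//|].
  by rewrite mem_filter => /andP[_ ->]; rewrite orbT.
- apply/fine_partitionP => //; rewrite cat_path last_cat/= lpost; split => //.
  rewrite !widen// -/p /fine_step pa ab/= !andbT.
  by rewrite (lt_trans apr) ?ltrDl// (lt_trans bar) ?ltrDl.
- apply/fine_partitionP => //; rewrite cat_path last_cat/= lpost; split => //.
  rewrite !widen// -/p /fine_step (lt_trans pa ab)/= !andbT.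
  by rewrite -(subrKA a b) ltrD.
- by move=> w; rewrite /S !stochastic_sumE !riemann_sum_cat/= -/p; ring.
Qed.

(** With [a] the left node and [p] the reference node just before it, Phi_a splits into (Phi_a -
    Phi_p) + Phi_p. By the isometry the first part contributes the mean square of a difference of
    two sums close to [X]; the second contributes a bounded moment times that of a short
    increment. *)
Lemma fine_terms_small e : 0 < e -> exists2 r, 0 < r &
  forall s, itv_partition 0 T s -> mesh s < r ->
  forall j, (j < size s)%N ->
    (ms (Phi (node s j)) * m2 (node s j.+1 - node s j) <= e%:E)%E.
Proof.
move=> e0; have e16 : 0 < e / 16 by rewrite divr_gt0.
have [r r0 rP] := ito_integral_cvg e16.
(* The reference partition has mesh below r / 2, so that the modified partitions have mesh below
   [r]. *)
have r20 : 0 < r / 2 by rewrite divr_gt0.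
have [s0 [s0P s0r] [M M0 MP]] := fine_partition_moments r20.
(* Chosen after [M], which depends on the reference partition: twice [M] times the moment bound 8 q
   is at most e / 2. Adding 1 keeps the denominator positive. *)
pose q := e / (32 * (M + 1)).
have q0 : 0 < q by rewrite divr_gt0// mulr_gt0// ltr_wpDl.
have Mq : 16 * M * q <= e / 2.
  rewrite /q mulrA ler_pdivrMr; last by rewrite mulr_gt0// ltr_wpDl.
  by nra.
exists (Num.min (r / 2) q); first by rewrite lt_min r20.
move=> s sP sr j jS; have := node_step_lt_mesh jS sr; rewrite lt_min => /andP[jr jq].
have a0 := node_ge0 sP jS; have ab := node_lt sP jS; have bT := node_le sP jS.
set a := node s j in jr jq a0 ab *; set b := node s j.+1 in jr jq ab bT *.
have ba0 : 0 < b - a by rewrite subr_gt0.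
have m2_0 : (0 <= m2 (b - a))%E by exact/ltW/increment_second_moment_gt0.
have bounded p : (ms (Phi p) <= M%:E)%E ->
    (2%:E * (ms (Phi p) * m2 (b - a)) <= (e / 2)%:E)%E.
  move=> pM; apply: (@le_trans _ _ (2%:E * (M%:E * (8 * q)%:E))%E).
    apply: lee_wpmul2l => //; apply: lee_pmul => //; first exact: mean_square_ge0.
    apply: (le_trans (increment_second_moment_le ba0)); rewrite lee_fin.
    by rewrite ler_wpM2l// ltW.
  by rewrite -!EFinM lee_fin (le_trans _ Mq)// le_eqVlt; apply/predU1P; left; ring.
(* No reference node precedes a = 0, but 0 is itself a reference node, so the bound [M] applies to
   Phi_0 directly. *)
have [a_gt0|a_le0] := ltP 0 a; last first.
  have -> : Phi a = Phi (node s0 0).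
    by congr Phi; apply/le_anti; rewrite [node s0 0]/= a_le0 a0.
  have s00 : (0 < size s0)%N.
    by case: (s0) s0P => // /itv_partition_nil T0E; move: T0; rewrite -T0E ltxx.
  have le_e2 := bounded _ (MP _ s00).
  apply: (@le_trans _ _ (2%:E * (ms (Phi (node s0 0)) * m2 (b - a)))%E).
    apply: lee_pemull; last by rewrite lee_fin ler1n.
    by rewrite mule_ge0// mean_square_ge0.
  by apply: (le_trans le_e2); rewrite lee_fin; lra.
have [p [s1 [s2 [ps0 pa [s1P s1r] [s2P s2r] S12]]]] :=
  riemann_sum_insert s0P s0r a_gt0 ab bT jr.
have r2E : r / 2 + r / 2 = r by lra.
rewrite r2E in s1r s2r.
have [i iS pE] := node_index s0P ps0 (lt_le_trans pa (le_trans (ltW ab) bT)).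
have p0 : 0 <= p by rewrite pE (node_ge0 s0P iS).
have mPa := adapted_measurable a0; have mPp := adapted_measurable p0.
(* Both sums are within e / 16 of [X] in mean square, and e / 4 is twice e / 16 plus twice e /
   16. *)
have small : (ms (Phi a \- Phi p)%R * m2 (b - a) <= (e / 4)%:E)%E.
  rewrite -mean_square_term//; last first.
    apply/measurable_wrt_filtrationP; apply: measurable_funB.
      by apply/measurable_wrt_filtrationP; exact: aPhi.
    apply/measurable_wrt_filtrationP => Y mY.
    by apply: (brownian_filtration_nondecreasing (ltW pa)); exact: aPhi.
  rewrite (_ : (fun w => _) = ((S s1 \- X) \- (S s2 \- X))%R); last first.
    by apply/funext => w /=; rewrite -S12; ring.
  apply: (le_trans (mean_squareB_le P _ _)).
  - by apply: measurable_funB => //; exact: mS.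
  - by apply: measurable_funB => //; exact: mS.
  rewrite (_ : (e / 4)%:E = 2%:E * (e / 16)%:E + 2%:E * (e / 16)%:E)%E; last first.
    by rewrite -!EFinM -EFinD; congr EFin; field.
  by apply: leeD; apply: lee_wpmul2l => //; apply/ltW/rP.
have -> : Phi a = ((Phi a \- Phi p) \+ Phi p)%R by apply/funext => w /=; rewrite subrK.
apply: (@le_trans _ _ ((2%:E * ms (Phi a \- Phi p)%R + 2%:E * ms (Phi p)) * m2 (b - a))%E).
  by apply: lee_wpmul2r => //; apply: mean_squareD_le => //; exact: measurable_funB.
rewrite ge0_muleDl; [|by rewrite mule_ge0// mean_square_ge0..].
rewrite -!muleA (_ : e%:E = 2%:E * (e / 4)%:E + (e / 2)%:E)%E; last first.
  by rewrite -EFinM -EFinD; congr EFin; field.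
apply: leeD; first exact: lee_wpmul2l.
by apply: bounded; rewrite pE; exact: MP.
Qed.

(** The remaining sum is the full sum minus the removed one, and by the isometry the mean square of
    the latter is a sum of at most [K] uniformly small terms, wherever they lie in the partition. *)
Lemma stochastic_sum_remove (K : nat) (J : forall s : seq R, {set 'I_(size s)}) :
    (forall s, itv_partition 0 T s -> (#|J s| <= K)%N) ->
  limit_in_mean_square P T
    (fun s => stochastic_sum B Phi ([set: 'I_(size s)] :\: J s)%SET) X.
Proof.
move=> JK; split; first by case: IX.
rewrite unlock; apply/mesh_cvg0P => [s|e e0].
  by apply: integral_ge0 => w _; rewrite lee_fin sqr_ge0.
have e8 : 0 < e / 8 by rewrite divr_gt0.
(* K + 1 avoids a division by zero at K = 0. The removed terms total at most e / 8, and the final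
   bound e / 2 is strictly below [e]. *)
have eK : 0 < e / (8 * K.+1%:R) by rewrite divr_gt0// mulr_gt0.
have [r1 r10 r1P] := ito_integral_cvg e8.
have [r2 r20 r2P] := fine_terms_small eK.
exists (Num.min r1 r2); first by rewrite lt_min r10.
move=> s sP; rewrite lt_min => /andP[sr1 sr2].
rewrite -/(mean_square P _).
rewrite (_ : (fun w => _) =
    ((S s \- X) \- stochastic_sum B Phi (J s))%R); last first.
  apply/funext => w /=; rewrite /S /stochastic_sum [X in X - _ - _](big_setID (J s)).
  by rewrite finset.setTI /= [RHS]addrAC [X in _ = X - _]addrAC subrr add0r.
apply: (le_lt_trans (mean_squareB_le P _ _)).
- by apply: measurable_funB => //; exact: mS.
- exact: stochastic_sum_measurable.
apply: (@le_lt_trans _ _ (2%:E * (e / 8)%:E + 2%:E * (e / 8)%:E)%E); last first.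
  by rewrite -!EFinM -EFinD lte_fin; lra.
apply: leeD; first by apply: lee_wpmul2l => //; exact/ltW/r1P.
apply: lee_wpmul2l => //; rewrite mean_square_stochastic_sum//.
apply: (@le_trans _ _ (\sum_(j in J s) (e / (8 * K.+1%:R))%:E)%E).
  by apply: lee_sum => j _; exact: r2P.
rewrite sumEFin sumr_const lee_fin -[leLHS]mulr_natr.
apply: (@le_trans _ _ (e / (8 * K.+1%:R) * K.+1%:R)).
  by rewrite ler_pM2l// ler_nat (leq_trans (JK s sP)).
by rewrite invfM mulrA divfK// pnatr_eq0.
Qed.

End ito_integrable.

End adapted_integrands.

(** * Integrands of class L0 *)

Section simple_integrands.
Context d (Omega : measurableType d) (R : realType) (P : probability Omega R).
Local Notation ms := (mean_square P).

Lemma mean_squareM_le (M : R) (g Y : Omega -> R) :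
    measurable_fun [set: Omega] g -> measurable_fun [set: Omega] Y ->
    (forall w, `|g w| <= M) ->
  (ms (g \* Y)%R <= (M ^+ 2)%:E * ms Y)%E.
Proof.
move=> mg mY gM; have mY2 : measurable_fun [set: Omega] (fun w => (Y w ^+ 2)%:E).
  exact/measurable_EFinP/measurable_funX.
rewrite -ge0_integralZl//; last 2 first.
- by move=> w _; rewrite lee_fin sqr_ge0.
- by rewrite lee_fin sqr_ge0.
apply: ge0_le_integral => //.
- by move=> w _; rewrite lee_fin sqr_ge0.
- by apply/measurable_EFinP; apply: measurable_funX; exact: measurable_funM.
- exact: emeasurable_funM.
move=> w _; rewrite -EFinM lee_fin exprMn ler_wpM2r ?sqr_ge0//.
by rewrite -real_normK ?num_real// lerXn2r// ?nnegrE// (le_trans _ (gM w)).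
Qed.

Lemma mean_square_lty_Lfun (X : Omega -> R) : measurable_fun [set: Omega] X ->
  (ms X < +oo)%E -> X \in Lfun P 2%:E.
Proof.
move=> mX Xfin; rewrite inE; apply/andP; split; rewrite inE//=.
rewrite /finite_norm unlock/= poweR_lty//.
rewrite (_ : (\int[P]_w _)%E = ms X)//; apply: eq_integral => w _.
by rewrite /= powR_mulrn// real_normK// num_real.
Qed.

Variable T : R.

(** Mean square convergence to 0, together with the measurability that makes it stable under sums
    and bounded measurable factors. *)
Definition vanishing (Y : seq R -> Omega -> R) : Prop :=
  (forall s, itv_partition 0 T s -> measurable_fun [set: Omega] (Y s)) /\
  forall e, 0 < e -> exists2 r, 0 < r &
    forall s, itv_partition 0 T s -> mesh s < r -> (ms (Y s) < e%:E)%E.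

Lemma vanishingD Y Z : vanishing Y -> vanishing Z ->
  vanishing (fun s => Y s \+ Z s).
Proof.
move=> [mY Y0] [mZ Z0]; split.
  by move=> s sP; apply: measurable_funD; [exact: mY|exact: mZ].
move=> e e0; have e4 : 0 < e / 4 by rewrite divr_gt0.
have [r r0 rP] := Y0 _ e4; have [q q0 qP] := Z0 _ e4.
exists (Num.min r q); first by rewrite lt_min r0.
move=> s sP; rewrite lt_min => /andP[sr sq].
apply: (le_lt_trans (mean_squareD_le P (mY s sP) (mZ s sP))).
rewrite (_ : e%:E = 2%:E * (e / 4)%:E + 2%:E * (e / 4)%:E)%E; last first.
  by rewrite -!EFinM -EFinD; congr EFin; field.
by apply: lteD; rewrite lte_pmul2l// ?rP// qP.
Qed.

Lemma vanishingM (M : R) (g : Omega -> R) Y : measurable_fun [set: Omega] g ->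
  (forall w, `|g w| <= M) -> vanishing Y -> vanishing (fun s => g \* Y s).
Proof.
move=> mg gM [mY Y0]; split.
  by move=> s sP; apply: measurable_funM => //; exact: mY.
move=> e e0; have M1 : 0 < M ^+ 2 + 1 by rewrite ltr_wpDl// sqr_ge0.
have [r r0 rP] := Y0 (e / (M ^+ 2 + 1)) (divr_gt0 e0 M1).
exists r => // s sP sr.
apply: (le_lt_trans (mean_squareM_le mg (mY s sP) gM)).
apply: (@le_lt_trans _ _ ((M ^+ 2 + 1)%:E * ms (Y s))%E).
  apply: lee_wpmul2r; first exact: mean_square_ge0.
  by rewrite lee_fin lerDl.
rewrite (_ : e%:E = (M ^+ 2 + 1)%:E * (e / (M ^+ 2 + 1))%:E)%E; last first.
  by rewrite -EFinM mulrC divfK// gt_eqF.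
by rewrite lte_pmul2l// rP.
Qed.

Lemma vanishing_sum (n : nat) (Y : nat -> seq R -> Omega -> R) :
  (forall k, (k < n)%N -> vanishing (Y k)) ->
  vanishing (fun s w => \sum_(k < n) Y k s w).
Proof.
elim: n => [|n IHn] Y0.
  split=> [s _|e e0].
    by under eq_fun do rewrite big_ord0; exact: measurable_cst.
  exists 1 => // s _ _; rewrite /mean_square integral0_eq// => w _.
  by rewrite big_ord0 expr0n.
under eq_fun do under eq_fun do rewrite big_ord_recr/=.
by apply: vanishingD; [apply: IHn => k kn; apply: Y0; exact: ltnW|exact: Y0].
Qed.

Variables (B : R -> Omega -> R) (hB : brownian_motion P B).
Hypothesis T0 : 0 < T.
Local Notation F := (brownian_filtration P B).

Lemma mean_square_increment_le (u v : R) : 0 <= u -> u <= v ->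
  (ms (B v \- B u)%R <= (8 * (v - u))%:E)%E.
Proof.
move=> u0; rewrite le_eqVlt => /predU1P[<-|uv].
  rewrite /mean_square integral0_eq ?subrr ?mulr0// => w _ /=.
  by rewrite subrr expr0n.
have := @mean_square_term _ _ _ P B hB u v (cst 1) u0 uv.
rewrite (_ : (fun w => _) = (B v \- B u)%R); last first.
  by apply/funext => w; rewrite mul1r.
move=> ->; last by apply/measurable_wrt_filtrationP; exact: measurable_cst.
rewrite /mean_square; under eq_integral do rewrite expr1n.
rewrite integral_cst// [X in (_ * X * _)%E]probability_setT !mul1e.
by apply: increment_second_moment_le; rewrite subr_gt0.
Qed.

(** The second moment of an increment is at most 8 times its length, which the mesh controls. *)
Lemma increment_vanishing (Y : seq R -> Omega -> R) :
    (forall e s, 0 < e -> itv_partition 0 T s -> mesh s < e ->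
      exists u v, [/\ 0 <= u, u <= v, v - u < e & Y s = (B v \- B u)%R]) ->
  vanishing Y.
Proof.
move=> YE; split.
  (* Measurability concerns partitions of any mesh, so the hypothesis is applied with the bound mesh
     s + 1. *)
  move=> s sP; have ms1 : mesh s < mesh s + 1 by rewrite ltrDl.
  have m0 : 0 <= mesh s by exact: bigmax_ge_id.
  have e0 : 0 < mesh s + 1 by rewrite ltr_wpDl.
  have [u [v [u0 uv _ ->]]] := YE _ s e0 sP ms1.
  by apply: (increment_measurable hB) => //; exact: le_trans uv.
move=> e e0; have e8 : 0 < e / 8 by rewrite divr_gt0.
exists (e / 8) => // s sP sr.
have [u [v [u0 uv vue ->]]] := YE _ s e8 sP sr.
apply: (le_lt_trans (mean_square_increment_le u0 uv)).
by rewrite lte_fin mulrC -ltr_pdivlMr.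
Qed.

Definition start_process (t : R) (_ : Omega) : R := \1_[set 0] t.

(** Indicator of ]a, +oo[, constant in the outcome. The indicator of ]a, b] is a difference of two
    of these, and their Riemann sums telescope. *)
Definition after_process (a t : R) (_ : Omega) : R := (a < t)%R%:R.

Lemma riemann_sum_cst (Phi : R -> Omega -> R) (c : R) x l w :
  {in x :: l, forall t, Phi t w = c} ->
  riemann_sum B Phi x l w = c * (B (last x l) w - B x w).
Proof.
elim: l x => [x _|y l IHl x Pc] /=; first by rewrite subrr mulr0.
rewrite IHl; last by move=> t tl; apply: Pc; rewrite inE tl orbT.
by rewrite Pc ?mem_head//; ring.
Qed.

(** Only the first interval has 0 as left endpoint, so the sum is the first increment of the
    partition. *)
Lemma start_process_vanishing :
  vanishing (fun s => stochastic_sum B start_process [set: 'I_(size s)]%SET).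
Proof.
apply: increment_vanishing => e s e0 sP se.
have [ps lT] := (fine_partitionP T s e0).1 (conj sP se).
case: s {sP se} ps lT => [_ /= T00|y l /= /andP[/andP[y0 ye] pl] lT].
  by move: T0; rewrite -T00 ltxx.
exists 0, y; split => //; first exact: ltW.
apply/funext => w; rewrite stochastic_sumE /=.
rewrite (@riemann_sum_cst _ 0).
  by rewrite /start_process indicE mem_set// mul1r mul0r addr0.
move=> t tl; rewrite /start_process indicE memNset//= => t00.
move: tl; rewrite inE t00 => /predU1P[y00|].
  by rewrite y00 ltxx in y0.
have /allP/[apply] := fine_path_all_lt pl.
by move=> /(lt_trans y0); rewrite ltxx.
Qed.

(** The sum telescopes from [u], the first node beyond [a], or the last node when none is beyond
    [a]; the minimum covers both cases. *)
Lemma after_process_sum (a e x : R) l : 0 < e -> path (fine_step e) x l -> x <= a ->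
  exists u, [/\ Num.min a (last x l) <= u, u - Num.min a (last x l) < e &
    forall w, riemann_sum B (after_process a) x l w = B (last x l) w - B u w].
Proof.
move=> e0; elim: l x => [x _ xa|y l IHl x /= /andP[/andP[xy yxe] pl] xa].
  by exists x; rewrite /= min_r// lexx subrr; split => // w; rewrite subrr.
have [ya|ay] := leP y a.
  have [u [u1 u2 uE]] := IHl y pl ya; exists u; split => // w.
  by rewrite uE /after_process ltNge xa mul0r add0r.
have yl : y <= last y l.
  have := mem_last y l; rewrite inE => /predU1P[->|ll]; first exact: lexx.
  by have /allP/(_ _ ll)/ltW := fine_path_all_lt pl.
exists y; rewrite min_l; last exact: le_trans (ltW ay) yl.
split; first exact: ltW.
  by apply: le_lt_trans yxe; rewrite lerB.
move=> w; rewrite (@riemann_sum_cst _ 1).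
  by rewrite /after_process ltNge xa mul0r add0r mul1r.
move=> t; rewrite inE /after_process => /predU1P[->|tl]; first by rewrite ay.
have /allP/(_ _ tl) yt := fine_path_all_lt pl.
by rewrite (lt_trans ay yt).
Qed.

Lemma after_process_vanishing (a : R) : 0 <= a ->
  vanishing (fun s w => B T w - B (Num.min a T) w -
    stochastic_sum B (after_process a) [set: 'I_(size s)]%SET w).
Proof.
move=> a0; apply: increment_vanishing => e s e0 sP se.
have [ps lT] := (fine_partitionP T s e0).1 (conj sP se).
have [u [u1 u2 uE]] := after_process_sum e0 ps a0.
rewrite lT in u1 u2 uE; exists (Num.min a T), u; split => //.
  by rewrite le_min a0 ltW.
by apply/funext => w /=; rewrite stochastic_sumE uE; ring.
Qed.

Section class_L0.
Variable Phi : R -> Omega -> R.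
Hypothesis PhiL0 : class_L0 F Phi.

(** Up to time [s m] the terms of index at least [m] vanish, so the series is a finite sum of fixed
    length there; some [s m] exceeds any given horizon. *)
Lemma class_L0_finite_sum : exists (s : nat -> R) (f : nat -> Omega -> R),
  [/\ s 0%N = 0 /\ nondecreasing_seq s, forall t, exists m, t <= s m,
      forall k, measurable_wrt (F (s k)) (f k),
      exists M, forall k w, `|f k w| <= M &
      forall m t w, 0 <= t -> t <= s m -> Phi t w = f 0%N w * start_process t w +
        \sum_(k < m) f k w * (after_process (s k) t w - after_process (s k.+1) t w)].
Proof.
have [s [f [s0 incs sy [mf fM] PhiE]]] := PhiL0.
have sS k : s k < s k.+1 by have /increasing_seqP := incs; exact.
exists s, f; split => //.
  by split => //; apply/nondecreasing_seqP => k; exact: ltW.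
  move=> t; have /cvgryPge/(_ t)[m _ mP] := sy.
  by exists m; apply: mP => /=.
move=> m t w t0 tm; rewrite PhiE//; congr (_ + _).
have indicE' k : \1_(`]s k, s k.+1]) t =
    after_process (s k) t w - after_process (s k.+1) t w :> R.
  rewrite /after_process indicE mem_setE in_itv/=.
  have [skt|tsk] := ltP (s k) t; last first.
    by rewrite ltNge (le_trans tsk (ltW (sS k)))/= subrr.
  by case: leP; rewrite /= ?subr0 ?subrr.
rewrite -(big_mkord xpredT (fun k => f k w *
  (after_process (s k) t w - after_process (s k.+1) t w))).
apply: lim_near_cst => //; exists m => // n /= mn.
rewrite /series/= (@big_cat_nat _ _ _ m)//= [X in _ + X]big1_seq ?addr0.
  by apply: eq_bigr => k _; rewrite indicE'.
move=> k /andP[_]; rewrite mem_index_iota => /andP[mk _].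
rewrite indicE' /after_process !ltNge.
have tk : t <= s k by rewrite (le_trans tm)// incs.
by rewrite tk (le_trans tk (ltW (sS k))) subrr mulr0.
Qed.

(** At time [t], the [f k] with s k <= t are F_t-measurable, and the others have coefficient 0. *)
Lemma class_L0_adapted : adapted F Phi.
Proof.
have [s [f [[s0 nds] sy mf _ PhiE]]] := class_L0_finite_sum.
move=> t t0; have [m tm] := sy t.
rewrite (_ : Phi t = fun w => f 0%N w * start_process t w +
    \sum_(k < m) f k w * (after_process (s k) t w - after_process (s k.+1) t w));
  last by apply/funext => w; exact: PhiE.
have fFt k : s k <= t -> @measurable_fun _ _ (g_sigma_algebraType (F t)) R setT (f k).
  move=> skt; apply/measurable_wrt_filtrationP => Y mY.
  by apply: (brownian_filtration_nondecreasing skt); exact: mf.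
apply/measurable_wrt_filtrationP; apply: measurable_funD.
  by apply: measurable_funM; [apply: fFt; rewrite s0|exact: measurable_cst].
apply: measurable_sum => k; rewrite /after_process.
have [skt|tsk] := leP (s k) t.
  by apply: measurable_funM; [exact: fFt|exact: measurable_cst].
rewrite !ltNge (ltW tsk) (le_trans (ltW tsk) (nds _ _ (leqnSn k)))/=.
under eq_fun do rewrite subrr mulr0.
exact: measurable_cst.
Qed.

Definition square_integrable (X : Omega -> R) :=
  measurable_fun [set: Omega] X /\ (ms X < +oo)%E.

Lemma square_integrable_sum (n : nat) (X : nat -> Omega -> R) :
  (forall k, square_integrable (X k)) ->
  square_integrable (fun w => \sum_(k < n) X k w).
Proof.
move=> X2; elim: n => [|n [mS S2]].
  under eq_fun do rewrite big_ord0; split; first exact: measurable_cst.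
  by rewrite /mean_square integral0_eq// => w _; rewrite expr0n.
under eq_fun do rewrite big_ord_recr/=.
have [mX X2n] := X2 n; split; first exact: measurable_funD.
apply: (le_lt_trans (mean_squareD_le P mS mX)).
by apply: lte_add_pinfty; rewrite lte_mul_pinfty.
Qed.

Lemma class_L0_ito_integrable : ito_integrable P B T Phi.
Proof.
have [s [f [[s0 nds] sy mf [M fM] PhiE]]] := class_L0_finite_sum.
have [m Tm] := sy T.
have s_ge0 k : 0 <= s k by rewrite -s0 nds.
have mfk k : measurable_fun [set: Omega] (f k).
  exact: (measurable_wrt_measurable hB (s_ge0 k)).
(* The limit of the sums of [after_process a]. *)
pose D a : Omega -> R := B T \- B (Num.min a T).
have D2 a : 0 <= a -> square_integrable (D a).
  move=> a0; have aT0 : 0 <= Num.min a T by rewrite le_min a0 ltW.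
  split; first by apply: (increment_measurable hB) => //; exact: ltW.
  apply: (le_lt_trans (mean_square_increment_le aT0 _)); last by rewrite ltry.
  by rewrite ge_min lexx orbT.
(* The elementary integral: each difference of [D] is the increment of [B] from [s k] to [s k.+1],
   both cut at [T]. *)
pose X w := \sum_(k < m) f k w * (D (s k) w - D (s k.+1) w).
have X2 : square_integrable X.
  apply: (@square_integrable_sum m (fun k => f k \* (D (s k) \- D (s k.+1)))) => k.
  have [m1 f1] := D2 _ (s_ge0 k); have [m2 f2] := D2 _ (s_ge0 k.+1).
  have mD : measurable_fun [set: Omega] (D (s k) \- D (s k.+1)) by exact: measurable_funB.
  split; first exact: measurable_funM.
  apply: (le_lt_trans (mean_squareM_le (mfk k) mD (fM k))).
  rewrite lte_mul_pinfty ?lee_fin ?sqr_ge0//.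
  apply: (le_lt_trans (mean_squareB_le P m1 m2)).
  by apply: lte_add_pinfty; rewrite lte_mul_pinfty.
exists X; split; first by apply: mean_square_lty_Lfun; case: X2.
pose A a (r : seq R) : Omega -> R :=
  stochastic_sum B (after_process a) [set: 'I_(size r)]%SET.
pose Z (r : seq R) : Omega -> R := stochastic_sum B start_process [set: 'I_(size r)]%SET.
have SE r w : itv_partition 0 T r ->
    stochastic_sum B Phi [set: 'I_(size r)]%SET w =
    f 0%N w * Z r w + \sum_(k < m) f k w * (A (s k) r w - A (s k.+1) r w).
  move=> rP; rewrite {1}/stochastic_sum.
  under eq_bigr => j _.
    have j0 := node_ge0 rP (ltn_ord j).
    have jT : node r j <= s m.
      by rewrite (le_trans _ Tm)// (le_trans (ltW (node_lt rP (ltn_ord j))))// (node_le rP).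
    rewrite (PhiE m)// mulrDl mulr_suml -mulrA.
    under eq_bigr do rewrite -mulrA mulrBl.
    over.
  rewrite big_split/= -mulr_sumr exchange_big/=; congr (_ + _).
  by apply: eq_bigr => k _; rewrite -mulr_sumr sumrB.
have vN Y : vanishing Y -> vanishing (fun r => cst (-1) \* Y r).
  by apply: (@vanishingM 1) => // w; rewrite normrN1.
(* The sum of [Phi] minus [X], arranged as bounded factors times vanishing families; subtraction is
   written as multiplication by -1. *)
have vSX : vanishing (fun r => (f 0%N \* Z r) \+ (fun w => \sum_(k < m)
    (f k \* ((fun w => D (s k.+1) w - A (s k.+1) r w) \+
      (cst (-1) \* (fun w => D (s k) w - A (s k) r w)))) w)).
  apply: vanishingD.
    exact: vanishingM (mfk 0%N) (fM 0%N) start_process_vanishing.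
  apply: (@vanishing_sum m (fun k r => f k \* ((fun w => D (s k.+1) w -
    A (s k.+1) r w) \+ (cst (-1) \* (fun w => D (s k) w - A (s k) r w))))) => k _.
  apply: (vanishingM (mfk k) (fM k)); apply: vanishingD.
    exact: after_process_vanishing.
  by apply: vN; exact: after_process_vanishing.
rewrite unlock; apply/mesh_cvg0P => [r|e e0].
  by apply: integral_ge0 => w _; rewrite lee_fin sqr_ge0.
have [_ /(_ e e0)[q q0 qP]] := vSX; exists q => // r rP rq.
have := qP r rP rq; congr (_ < _)%E; apply: eq_integral => w _.
congr (_ ^+ 2)%:E; rewrite SE//= -addrA; congr (_ + _).
by rewrite /X -sumrB; apply: eq_bigr => k _; rewrite /=; ring.
Qed.

End class_L0.

End simple_integrands.

Theorem theorem1 (R : realType) (d : measure_display)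
    (Omega : measurableType d) (P : probability Omega R)
    (B : R -> Omega -> R) (hB : brownian_motion P B)
    (T : R) (hT : 0 < T)
    (Phi : R -> Omega -> R)
    (hPhi : class_L0 (brownian_filtration P B) Phi \/
            class_L2 P (brownian_filtration P B) T Phi \/
            class_L2_loc P (brownian_filtration P B) T Phi)
    (hint : class_L0 (brownian_filtration P B) Phi \/
            ito_integrable P B T Phi)
    (K : nat) (hK : (1 <= K)%N)
    (JK : forall s : seq R, {set 'I_(size s)})
    (hJK : forall s : seq R, itv_partition 0 T s -> (K < size s)%N ->
           #|JK s| = K) :
  limit_in_mean_square P T
    (fun s => stochastic_sum B Phi ([set: 'I_(size s)] :\: JK s)%SET)
    (ito_integral P B T Phi).
Proof.
have aPhi : adapted (brownian_filtration P B) Phi.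
  by case: hPhi => [/class_L0_adapted //|[] []].
(* For class L0 the elementary integral provides the limit; otherwise its existence is the
   hypothesis [hint]. *)
have IPhi : ito_integrable P B T Phi.
  by case: hint => // /(class_L0_ito_integrable hB hT).
have IX : is_ito_integral P B T Phi (ito_integral P B T Phi).
  by have [X XP] := IPhi; exact: (xgetPex (cst 0) (ex_intro _ X XP)).
apply: (stochastic_sum_remove hB hT aPhi IX (K := K)) => s sP.
(* [hJK] speaks only of partitions with more than [K] intervals; otherwise any set of indices has at
   most size s <= K elements. *)
have [sK|Ks] := leqP (size s) K; last by rewrite hJK.
by rewrite (leq_trans (max_card _))// card_ord.
Qed.
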